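(* Let $q$ be a power of $2$, let $n\ge 2$, and let $\mathcal{P}_{n,2}$ be the line orthogonal Grassmann code associated with a non-degenerate quadratic form on a vector space of dimension $2n+1$ over $\mathbb{F}_q$. Then: (1) the minimum distance of $\mathcal{P}_{n,2}$ is $$d_{\min}=q^{4n-5}-q^{3n-4};$$ (2) all codewords of minimum weight of $\mathcal{P}_{n,2}$ are projectively equivalent; (3) if $n\neq 3$, the second smallest distance of $\mathcal{P}_{n,2}$ (that is, the second smallest non-zero value attained as the Hamming weight of a codeword) is $q^{4n-5}-q^{2n-3}$.
   Context: Let $V=V(2n+1,q)$ be a vector space of dimension $2n+1$ over $\mathbb{F}_q$ and let $\eta:V\to\mathbb{F}_q$ be a non-degenerate quadratic form (for $q$ even all such forms are equivalent up to a change of basis and a scalar; one may take $\eta(x)=\sum_{i=1}^n x_{2i-1}x_{2i}+x_{2n+1}^2$). Let $\beta(x,y)=\eta(x+y)-\eta(x)-\eta(y)$. Let $\Delta_2$ be the set of all $2$-dimensional subspaces of $V$ that are totally singular for $\eta$ (''lines'' of the parabolic quadric). Let $\varepsilon_2$ be the Plücker embedding $\langle v_1,v_2\rangle\mapsto\langle v_1\wedge v_2\rangle\in \mathrm{PG}(\bigwedge^2V)$, and let $\Omega=\varepsilon_2(\Delta_2)=\{\omega_1,\dots,\omega_M\}$, where for each point a vector representative $\omega_i=v_1\wedge v_2$ is fixed. The line orthogonal Grassmann code $\mathcal{P}_{n,2}$ is the linear code of length $M=|\Delta_2|$ whose codewords are $c_\varphi=(\varphi(\omega_1),\dots,\varphi(\omega_M))$,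 as $\varphi$ ranges over the linear functionals on $\bigwedge^2 V$ (equivalently, alternating bilinear forms on $V$, with $\varphi(v_1\wedge v_2)=\varphi(v_1,v_2)$). It is well defined up to monomial equivalence (choice of representatives). For $q$ even, $c_\varphi=c_\vartheta$ if and only if $\varphi-\vartheta=a\beta$ for some $a\in\mathbb{F}_q$. Projective equivalence of codewords: $c_\varphi$ and $c_\psi$ are projectively equivalent if there is an invertible linear map $g:V\to V$ preserving $\eta$ up to a non-zero scalar and a non-zero $a\in\mathbb{F}_q$ such that $\psi(x,y)-a\,\varphi(gx,gy)=b\,\beta(x,y)$ for all $x,y\in V$, for some $b\in\mathbb{F}_q$. *)

(* Defs.v *)
From mathcomp Require Import all_boot all_order all_algebra.

Set Implicit Arguments.
Unset Strict Implicit.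
Unset Printing Implicit Defensive.

Import GRing.Theory.

Local Open Scope ring_scope.

Definition least (P : nat -> Prop) (d : nat) : Prop :=
  P d /\ forall k, P k -> (d <= k)%N.

Definition second_least (P : nat -> Prop) (d : nat) : Prop :=
  least (fun k => P k /\ exists2 j, P j & (j < k)%N) d.

Section Forms.
Variables (F : fieldType) (V : vectType F).

Definition polar (eta : V -> F) (x y : V) : F := eta (x + y) - eta x - eta y.

Definition quadratic_form (eta : V -> F) : Prop :=
  (forall a x, eta (a *: x) = a ^+ 2 * eta x)
  /\ bilinear_for *%R *%R (polar eta).

(* In characteristic 2 and odd dimension the polar form is alternating, hence
   always degenerate: non-degeneracy means that eta has no nonzero zero in the
   radical of its polar form. *)
Definition nondegenerate_quadratic_form (eta : V -> F) : Prop :=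
  quadratic_form eta
  /\ forall x, (forall y, polar eta x y = 0) -> eta x = 0 -> x = 0.

Definition alternating_form (phi : V -> V -> F) : Prop :=
  bilinear_for *%R *%R phi /\ forall x, phi x x = 0.

Definition singular_line (eta : V -> F) (L : {vspace V}) : Prop :=
  \dim L = 2%N /\ forall x, x \in L -> eta x = 0.

Definition line_of (p : V * V) : {vspace V} := (<[p.1]> + <[p.2]>)%VS.

(* omega i = (v1, v2) stands for the vector v1 /\ v2 of the exterior square, so
   that omega fixes one vector representative of the Pluecker image of each
   singular line.  Every representative has this form, since
   a (v1 /\ v2) = (a v1) /\ v2. *)
Definition line_representatives (eta : V -> F) (M : nat)
    (omega : 'I_M -> V * V) : Prop :=
  [/\ forall i, singular_line eta (line_of (omega i)),
      injective (fun i => line_of (omega i))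
    & forall L, singular_line eta L -> exists i, line_of (omega i) = L].

(* Alternating bilinear forms phi are the linear functionals on the exterior
   square, through phi (v1 /\ v2) = phi v1 v2. *)
Definition codeword (M : nat) (omega : 'I_M -> V * V) (phi : V -> V -> F) :
    'rV[F]_M :=
  \row_i phi (omega i).1 (omega i).2.

Definition line_code (M : nat) (omega : 'I_M -> V * V) (c : 'rV[F]_M) : Prop :=
  exists2 phi, alternating_form phi & c = codeword omega phi.

Definition projectively_equivalent (eta : V -> F) (phi psi : V -> V -> F) :
    Prop :=
  exists (g : 'End(V)) (s a b : F),
    [/\ lker g = 0%VS,
        s != 0 /\ forall x, eta (g x) = s * eta x,
        a != 0
      & forall x y, psi x y - a * phi (g x) (g y) = b * polar eta x y].

End Forms.

Section Codes.
Variables (F : fieldType) (M : nat).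

Definition hamming_distance (c d : 'rV[F]_M) : nat :=
  #|[set i | c 0 i != d 0 i]|.

Definition hamming_weight (c : 'rV[F]_M) : nat := hamming_distance c 0.

Definition minimum_distance (C : 'rV[F]_M -> Prop) (d : nat) : Prop :=
  least (fun k => exists c c',
    [/\ C c, C c', c <> c' & k = hamming_distance c c']) d.

Definition nonzero_weight (C : 'rV[F]_M -> Prop) (w : nat) : Prop :=
  (0 < w)%N /\ exists2 c, C c & w = hamming_weight c.

Definition minimum_weight_codeword (C : 'rV[F]_M -> Prop) (c : 'rV[F]_M) :
    Prop :=
  C c /\ least (nonzero_weight C) (hamming_weight c).

Definition second_smallest_distance (C : 'rV[F]_M -> Prop) (d : nat) : Prop :=
  second_least (nonzero_weight C) d.

End Codes.

(* Main.v *)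
Require Import Defs.
From mathcomp Require Import all_boot all_order all_algebra all_field.
From mathcomp Require Import ring zify.

Set Implicit Arguments.
Unset Strict Implicit.
Unset Printing Implicit Defensive.

Import Order.TTheory GRing.Theory Num.Theory.

Local Open Scope ring_scope.

(** Write beta for the polar form of eta, <r> for its radical (the nucleus) and,
    for an alternating form phi, R_l for the radical of phi - l beta.  The
    singular vectors are counted with the quadratic Gauss sums
    G(U) = sum_(y in U) chi (eta y), where chi : F -> {1, -1} is the additive
    character given by the absolute trace.  A double count over the pencil
    (phi - l beta)_l gives the exact weight of the codeword of phi:

      (q^2 - 1) wt(phi) = q^(4n-3) + q^(2n-2) - q^(2n-3) - q^(2n-4) Theta,
      Theta = sum_l (|R_l| + (q^2 - 1) G(R_l)),

    so that small weights correspond to large values of Theta.  The R_l have odd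
    dimension, are mutually beta-orthogonal and meet only inside <r>.  If r lies
    in the radical of phi, then all G(R_l) vanish and the sum of the |R_l| is
    largest for one R_l of codimension 2 and another one of dimension 3; this is
    the second weight.  Otherwise the G(R_l) add up to at most q^n, and Theta is
    large only if some R_l has codimension 2; the maximum is attained exactly
    when R_l is a cone, with a singular vertex, over a hyperbolic quadric.  In a
    hyperbolic basis such a phi - l beta is a multiple of the wedge of two fixed
    coordinates, whence the uniqueness up to equivalence. *)

(** The weight counts singular pairs with [beta x y = 0] and [phi x y <> 0], so it involves the
    common perp of x under beta and phi. If [beta x y <> 0], exactly one l makes phi - l beta vanish
    at (x, y); if [beta x y = 0], all l do or none. The joint condition is therefore a linear
    combination of conditions on one form each, and summing these over the other variable leaves
    only radicals.

    Read backwards, the same identity bounds the sum of the G(R_l): up to a factor it is a sum over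
    singular x of Gauss sums of common perps, each at most q^n and zero as soon as the perp contains
    r.

    The case n = 3 escapes part (3) when r is outside the radical of phi and no R_l has codimension
    2. The bound on Theta is then q^(2n-3) + (q-1) q^n + (q^2-1) q^n; it does not exceed the value
    belonging to the second weight when n >= 4, but it does when n = 3 and q > 2. For n = 2 a
    geometric argument replaces it: all R_l have dimension 1, and at most two of them are
    singular. *)

Lemma sum_neq_const (T : finType) (x0 : T) (c : int) :
  \sum_(x | x != x0) c = (#|T|%:Z - 1) * c.
Proof.
rewrite sumr_const -mulr_natl natz; congr (_ * _).
have -> : #|(fun x : T => x != x0)| = #|predC1 x0| by [].
by rewrite cardC1 predn_int // (cardD1 x0).
Qed.

(** Serves for the radicals of a pencil, which are disjoint away from the multiples of the
    nucleus. *)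
Lemma sum_card_disjoint (I T : finType) (P : pred I) (A : I -> pred T) (B : pred T) :
  (forall i, P i -> {subset A i <= B}) ->
  (forall i j x, P i -> P j -> x \in A i -> x \in A j -> i = j) ->
  (\sum_(i | P i) #|A i| <= #|B|)%N.
Proof.
move=> sAB disj; rewrite -[leqRHS]sum1_card.
under eq_bigr do rewrite -sum1_card.
rewrite (exchange_big_dep (mem B)) /= => [|i x Pi /(sAB i Pi) //].
apply: leq_sum => x Bx; rewrite sum1_card; apply/card_le1_eqP => i j.
by move=> /andP[Pi Ai] /andP[Pj Aj]; apply: (disj j i x).
Qed.

Section FieldCardinality.
Variable F : finFieldType.
Local Notation q := (#|F|%:Z).

Lemma card_field_gt1 : (1 < #|F|)%N.
Proof. exact: finNzRing_gt1. Qed.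

Lemma card_field_gt0 : 0 < q.
Proof. by rewrite ltz_nat (ltn_trans _ card_field_gt1). Qed.

Lemma card_field_ge2 : 2 <= q.
Proof. by rewrite lez_nat card_field_gt1. Qed.

End FieldCardinality.

(** * An additive character in characteristic 2 *)

Section BinaryCharacter.
Variables (F : finFieldType) (e : nat).
Hypothesis card_F : #|F| = (2 ^ e)%N.

Lemma pchar2_of_card : 2%N \in [pchar F].
Proof. exact: (card_finPcharP card_F). Qed.

Let addxx (x : F) : x + x = 0.
Proof. exact: addrr_pchar2 pchar2_of_card x. Qed.

(** The trace to the prime field, with values kept in F: being fixed by squaring, they are 0 or
    1. *)
Definition abs_trace (a : F) : F := \sum_(i < e) a ^+ (2 ^ i).

Lemma sqrD2 (a b : F) : (a + b) ^+ 2 = a ^+ 2 + b ^+ 2.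
Proof. by rewrite sqrrD mulr2n addxx addr0. Qed.

(** Squaring is injective in characteristic 2, hence bijective on a finite field. This allows any
    scalar factor of eta to be absorbed by rescaling vectors. *)
Lemma sqr_root (a : F) : exists b, a = b ^+ 2.
Proof.
have sqr_inj : injective (fun b : F => b ^+ 2).
  move=> b c /eqP; rewrite -subr_eq0 subr_sqr mulf_eq0 => /orP[].
    by rewrite subr_eq0 => /eqP.
  by rewrite addr_eq0 (oppr_pchar2 pchar2_of_card) => /eqP.
by exists (invF sqr_inj a); rewrite (f_invF sqr_inj).
Qed.

Lemma abs_traceD a b : abs_trace (a + b) = abs_trace a + abs_trace b.
Proof.
rewrite /abs_trace -big_split; apply: eq_bigr => i _ /=.
elim: (val i) => [|k IHk]; first by rewrite !expr1.
by rewrite expnSr !exprM IHk sqrD2.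
Qed.

(** Squaring permutes the conjugates cyclically, because a^(2^e) = a. *)
Lemma abs_trace_sqr a : abs_trace (a ^+ 2) = abs_trace a.
Proof.
have e_gt0 : (0 < e)%N.
  by case: e card_F (finNzRing_gt1 F) => // ->.
rewrite /abs_trace -(prednK e_gt0) big_ord_recr [RHS]big_ord_recl /= addrC.
congr (_ + _); last by apply: eq_bigr => i _; rewrite -exprM -expnS.
by rewrite -exprM -expnS prednK // -card_F expf_card expr1.
Qed.

Lemma sqr_abs_trace a : abs_trace a ^+ 2 = abs_trace a.
Proof.
rewrite -[RHS]abs_trace_sqr /abs_trace.
rewrite (big_morph (fun x : F => x ^+ 2) sqrD2 (expr0n _ 2)).
by apply: eq_bigr => i _; rewrite -!exprM mulnC.
Qed.

Lemma abs_trace01 a : (abs_trace a == 0) || (abs_trace a == 1).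
Proof.
have := sqr_abs_trace a; move/eqP; rewrite -subr_eq0 expr2 -{3}[abs_trace a]mulr1.
by rewrite -mulrBr mulf_eq0 subr_eq0.
Qed.

(** The trace is a nonzero polynomial of degree at most 2^(e-1), too small to vanish at all 2^e
    elements. *)
Lemma abs_trace_neq0 : exists a, abs_trace a != 0.
Proof.
apply/existsP; apply: contraT; rewrite negb_exists => /forallP tr0.
have e_gt0 : (0 < e)%N.
  by case: e card_F (finNzRing_gt1 F) => // ->.
pose p : {poly F} := \sum_(i < e) 'X^(2 ^ i).
have p_neq0 : p != 0.
  (* The coefficient of X comes from the term i = 0 alone, so it is 1. *)
  apply/eqP => /(congr1 (fun r : {poly F} => r`_1)); rewrite coef0 coef_sum.
  rewrite (bigD1 (Ordinal e_gt0)) //= coefXn eqxx big1 ?addr0 => [/eqP|i ne_i0].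
    by rewrite oner_eq0.
  rewrite coefXn; case: eqP => // /esym/eqP.
  by rewrite -[1%N](expn0 2) eqn_exp2l //; move: ne_i0; rewrite -val_eqE /= => /negbTE->.
have all_roots : all (root p) (enum F).
  apply/allP => a _; rewrite /root horner_sum.
  under eq_bigr do rewrite hornerXn.
  by have := tr0 a; rewrite negbK.
have := max_poly_roots p_neq0 all_roots (enum_uniq F).
rewrite -cardE card_F; apply: contraTT => _; rewrite -leqNgt; apply: leq_trans (_ : (2 ^ e.-1).+1 <= _)%N.
  apply/(leq_trans (size_sum _ _ _))/bigmax_leqP => i _.
  by rewrite size_polyXn ltnS leq_exp2l // -ltnS prednK.
by rewrite -[in leqRHS](prednK e_gt0) expnS mul2n -addnn -addn1 leq_add2l expn_gt0.
Qed.

(** In characteristic 2 the values are signs; taking them in [int] makes Gauss sums integers, which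
    can be compared by order. *)
Definition chi (a : F) : int := if abs_trace a == 0 then 1 else -1.

Lemma chi0 : chi 0 = 1.
Proof.
rewrite /chi /abs_trace big1 ?eqxx // => i _.
by rewrite expr0n expn_eq0.
Qed.

Lemma chiD a b : chi (a + b) = chi a * chi b.
Proof.
rewrite /chi abs_traceD.
have [/eqP-> | /eqP->] := orP (abs_trace01 a); first by rewrite add0r eqxx mul1r.
have [/eqP-> | /eqP->] := orP (abs_trace01 b); rewrite ?addr0 ?addxx ?eqxx ?oner_eq0 //.
Qed.

Lemma chi_sqr a : chi (a ^+ 2) = chi a.
Proof. by rewrite /chi abs_trace_sqr. Qed.

Lemma chi_pm1 a : (chi a == 1) || (chi a == -1).
Proof. by rewrite /chi; case: ifP. Qed.

Lemma chi_mulxx a : chi a * chi a = 1.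
Proof. by rewrite -chiD addxx chi0. Qed.

Lemma chi_eqN1 : exists a, chi a = -1.
Proof. by have [a tr_a] := abs_trace_neq0; exists a; rewrite /chi (negbTE tr_a). Qed.

Lemma sum_chi : \sum_c chi c = 0.
Proof.
have [w chi_w] := chi_eqN1.
have : \sum_c chi c = - \sum_c chi c.
  rewrite {1}(reindex_inj (addrI w)) /= -sumrN; apply: eq_bigr => c _.
  by rewrite chiD chi_w mulN1r.
by lia.
Qed.

(** Orthogonality: the sum over c detects t = 0, which turns q times a number of zeros into a
    character sum. *)
Lemma sum_chiM t : \sum_c chi (c * t) = if t == 0 then #|F|%:Z else 0.
Proof.
case: eqP => [-> | /eqP t_neq0].
  by under eq_bigr do rewrite mulr0 chi0; rewrite sumr_const cardT -cardE natz.
rewrite -[RHS]sum_chi [RHS](reindex_inj (mulIf t_neq0)) //=.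
Qed.

End BinaryCharacter.

(** * Alternating forms *)

Section AlternatingForms.
Variables (F : fieldType) (V : vectType F).
Implicit Types (psi : V -> V -> F) (x y z : V) (a b : F).

Lemma altDl psi : alternating_form psi -> forall x y z, psi (x + y) z = psi x z + psi y z.
Proof. by move=> [[lin_l _] _] x y z; have := lin_l z 1 x y; rewrite scale1r /= mul1r. Qed.

Lemma altDr psi : alternating_form psi -> forall x y z, psi z (x + y) = psi z x + psi z y.
Proof. by move=> [[_ lin_r] _] x y z; have := lin_r z 1 x y; rewrite scale1r /= mul1r. Qed.

Lemma alt0l psi : alternating_form psi -> forall z, psi 0 z = 0.
Proof.
by move=> alt_psi z; have /eqP := altDl alt_psi 0 0 z;
  rewrite addr0 -subr_eq0 opprD addrA subrr add0r oppr_eq0 => /eqP.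
Qed.

Lemma alt0r psi : alternating_form psi -> forall z, psi z 0 = 0.
Proof.
by move=> alt_psi z; have /eqP := altDr alt_psi 0 0 z;
  rewrite addr0 -subr_eq0 opprD addrA subrr add0r oppr_eq0 => /eqP.
Qed.

Lemma altZl psi : alternating_form psi -> forall a x z, psi (a *: x) z = a * psi x z.
Proof.
by move=> alt_psi a x z; have := alt_psi.1.1 z a x 0; rewrite addr0 /= alt0l // addr0.
Qed.

Lemma altZr psi : alternating_form psi -> forall a x z, psi z (a *: x) = a * psi z x.
Proof.
by move=> alt_psi a x z; have := alt_psi.1.2 z a x 0; rewrite addr0 /= alt0r // addr0.
Qed.

Lemma altxx psi : alternating_form psi -> forall x, psi x x = 0.
Proof. by case. Qed.

Lemma altC psi : alternating_form psi -> forall x y, psi y x = - psi x y.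
Proof.
move=> alt_psi x y; have := altxx alt_psi (x + y).
rewrite altDl // !altDr // !altxx // add0r addr0 => /eqP.
by rewrite addr_eq0 => /eqP->; rewrite opprK.
Qed.

Lemma altC_eq0 psi : alternating_form psi -> forall x y, (psi y x == 0) = (psi x y == 0).
Proof. by move=> alt_psi x y; rewrite altC // oppr_eq0. Qed.

(** All members of the pencil give the same codeword, since beta vanishes on singular lines. *)
Definition pencil (phi beta : V -> V -> F) (l : F) (x y : V) : F :=
  phi x y - l * beta x y.

Lemma alternating_pencil phi beta l :
  alternating_form phi -> alternating_form beta -> alternating_form (pencil phi beta l).
Proof.
move=> alt_phi alt_beta; split; last by move=> x; rewrite /pencil !altxx // mulr0 subrr.
split=> z a x y; rewrite /pencil /=.
  by rewrite !altDl // !altZl //; ring.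
by rewrite !altDr // !altZr //; ring.
Qed.

Definition wedge (f g : V -> F) (x y : V) : F := f x * g y - f y * g x.

Lemma alternating_wedge f g : scalar f -> scalar g -> alternating_form (wedge f g).
Proof.
move=> lin_f lin_g; split; last by move=> x; rewrite /wedge subrr.
by split=> z a x y; rewrite /wedge /= !lin_f !lin_g; ring.
Qed.

End AlternatingForms.

(** * Orthogonal subspaces and their dimensions over a finite field *)

Section PerpSpaces.
(* finvect_type V0 is V0 itself, equipped with the finType structure that
   cardinals and sums over vectors require. *)
Variables (F : finFieldType) (V0 : vectType F).
Local Notation V := (finvect_type V0).
Implicit Types (psi : V -> V -> F) (a b x y z : V) (A B U : {vspace V}).

(** A span, so that it makes sense for any function psi; when psi is alternating the spanning set is
    already a subspace. *)
Definition perpv psi A : {vspace V} :=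
  <<enum [pred x : V | [forall y : V, (y \in A) ==> (psi y x == 0%R)]]>>%VS.

Lemma memv_perp psi A x : alternating_form psi ->
  reflect (forall y, y \in A -> psi y x = 0) (x \in perpv psi A).
Proof.
move=> alt_psi; rewrite /perpv; set s := enum _.
have mem_s z : (z \in s) = [forall y : V, (y \in A) ==> (psi y z == 0)].
  by rewrite mem_enum inE.
apply: (iffP idP) => [/coord_span-> y Ay | Ax]; last first.
  apply: memv_span; rewrite mem_s; apply/forallP => y; apply/implyP => Ay.
  by rewrite Ax.
rewrite (big_morph (psi y) (fun u v => altDr alt_psi u v y) (alt0r alt_psi y)).
rewrite big1 // => i _; rewrite altZr //.
have : s`_i \in s by rewrite mem_nth // -cardE.
rewrite mem_s => /forallP/(_ y).
by rewrite Ay => /eqP->; rewrite mulr0.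
Qed.

Definition radv psi := perpv psi fullv.

Lemma memv_radv psi x : alternating_form psi ->
  reflect (forall y, psi x y = 0) (x \in radv psi).
Proof.
move=> alt_psi; apply: (iffP (memv_perp _ _ alt_psi)) => x0 y.
  by rewrite altC // x0 ?oppr0 ?memvf.
by move=> _; rewrite altC // x0 oppr0.
Qed.

Lemma perpS psi A B : alternating_form psi ->
  (A <= B)%VS -> (perpv psi B <= perpv psi A)%VS.
Proof.
move=> alt_psi sAB; apply/subvP => x /memv_perp Bx; apply/memv_perp => // y Ay.
by apply: Bx => //; apply: (subvP sAB).
Qed.

Lemma memv_perp_line psi x y : alternating_form psi ->
  (y \in perpv psi <[x]>%VS) = (psi x y == 0).
Proof.
move=> alt_psi; apply/(memv_perp _ _ alt_psi)/eqP => [-> // | xy0 z].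
  exact: memv_line.
by case/vlineP => a ->; rewrite altZl // xy0 mulr0.
Qed.

Lemma perpD psi A B : alternating_form psi ->
  perpv psi (A + B) = (perpv psi A :&: perpv psi B)%VS.
Proof.
move=> alt_psi; apply/eqP; rewrite eqEsubv; apply/andP; split.
  by rewrite subv_cap !perpS ?addvSl ?addvSr.
apply/subvP => x; rewrite memv_cap => /andP[/memv_perp Ax /memv_perp Bx].
apply/memv_perp => // _ /memv_addP[u Au [v Bv ->]].
by rewrite altDl // Ax // Bx // addr0.
Qed.

Lemma sub_perpC psi A B : alternating_form psi ->
  (A <= perpv psi B)%VS = (B <= perpv psi A)%VS.
Proof.
move=> alt_psi; wlog suff: A B / (A <= perpv psi B)%VS -> (B <= perpv psi A)%VS.
  by move=> imp; apply/idP/idP; apply: imp.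
move=> /subvP sAB; apply/subvP => x Bx; apply/memv_perp => // y Ay.
by have /memv_perp/(_ x Bx) := sAB y Ay => /(_ alt_psi); rewrite altC // => /eqP; rewrite oppr_eq0 => /eqP.
Qed.

Lemma card_vspaceE U : #|U| = (#|F| ^ \dim U)%N.
Proof. exact: card_vspace. Qed.

Lemma card_vspace_exp U : #|U|%:Z = #|F|%:Z ^+ \dim U.
Proof. by rewrite card_vspaceE -natz natrX natz. Qed.

Section CharacterSums.
Variable e : nat.
Hypothesis card_F : #|F| = (2 ^ e)%N.
Local Notation q := (#|F|%:Z).
Local Notation chi := (chi e).

(** Translation by w permutes U and changes the sign of every term, so the sum is its own
    opposite. *)
Lemma sum_chi_shift (h : V -> F) U w : w \in U ->
  (forall y, y \in U -> chi (h (y + w)) = - chi (h y)) -> \sum_(y in U) chi (h y) = 0.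
Proof.
move=> Uw hw; have : \sum_(y in U) chi (h y) = - \sum_(y in U) chi (h y).
  rewrite {1}(reindex_inj (addIr w)) /= -sumrN; apply: eq_big => y.
    by rewrite rpredDr.
  by rewrite rpredDr // => /hw.
lia.
Qed.

Lemma sum_chi_linear (h : V -> F) U : scalar h ->
  \sum_(y in U) chi (h y) = if [forall y in U, h y == 0] then #|U|%:Z else 0.
Proof.
move=> lin_h; case: ifPn => [/forall_inP h0 | /forall_inPn[u Uu h_u]].
  rewrite (eq_bigr (fun _ => 1)) => [|y Uy]; first by rewrite sumr_const natz.
  by rewrite (eqP (h0 y Uy)) chi0.
have [w chi_w] := chi_eqN1 card_F.
apply: (sum_chi_shift (w := (w / h u) *: u)) => [|y Uy]; first by rewrite rpredZ.
by rewrite addrC lin_h /= divfK // addrC chiD // chi_w mulrN1.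
Qed.

(** The zeros of h are detected by summing chi (c * h y) over c. For c <> 0 the functional c h is
    nonzero on U and its character sum vanishes, so only c = 0 contributes. *)
Lemma card_kernel (h : V -> F) U u : scalar h -> u \in U -> h u != 0 ->
  q * #|[pred y in U | h y == 0]|%:Z = #|U|%:Z.
Proof.
move=> lin_h Uu h_u.
have <-: \sum_(y in U) \sum_c chi (c * h y) = q * #|[pred y in U | h y == 0]|%:Z.
  rewrite (eq_bigr _ (fun y _ => sum_chiM card_F (h y))) -big_mkcondr sumr_const.
  by rewrite -mulr_natr natz; congr (_ * _).
rewrite exchange_big (bigD1 0) //= [X in _ + X]big1 ?addr0 => [|c c_neq0].
  rewrite (eq_bigr (fun _ => 1)) => [|y Uy]; first by rewrite sumr_const natz.
  by rewrite mul0r chi0.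
have lin_ch : scalar (fun y => c * h y).
  by move=> a x y; rewrite lin_h /=; ring.
rewrite (sum_chi_linear _ lin_ch); case: ifP => // /forall_inP/(_ u Uu).
by rewrite mulf_eq0 (negbTE c_neq0) (negbTE h_u).
Qed.

Lemma dim_cap_perp_line psi U x u : alternating_form psi ->
  u \in U -> psi x u != 0 -> (\dim (U :&: perpv psi <[x]>)).+1 = \dim U.
Proof.
move=> alt_psi Uu xu; have := card_kernel (h := psi x) (alt_psi.1.2 x) Uu xu.
rewrite (eq_card (B := (U :&: perpv psi <[x]>)%VS)) => [|y]; last first.
  by rewrite !inE memv_cap memv_perp_line.
rewrite !card_vspaceE -PoszM -expnS => -[/eqP].
by rewrite eqn_exp2l ?(card_field_gt1 F) // => /eqP.
Qed.

(** Double count of the sum of chi (psi a x) over a in A and x in V: summing first over a selects x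
    in the perp of A, summing first over x selects a in the radical. *)
Lemma dim_perp psi A : alternating_form psi ->
  (\dim A + \dim (perpv psi A) = \dim (fullv : {vspace V}) + \dim (A :&: radv psi))%N.
Proof.
move=> alt_psi; apply/eqP; rewrite -(eqn_exp2l _ _ (card_field_gt1 F)) !expnD -!card_vspaceE.
have dbl: \sum_(a in A) \sum_(x : V) chi (psi a x) = \sum_(x : V) \sum_(a in A) chi (psi a x).
  exact: exchange_big.
apply/eqP; suff: #|A|%:Z * #|perpv psi A|%:Z = #|(fullv : {vspace V})|%:Z * #|(A :&: radv psi)%VS|%:Z.
  by rewrite -!PoszM => -[].
transitivity (\sum_(x : V) \sum_(a in A) chi (psi a x)).
  rewrite (eq_bigr (fun x : V => if x \in perpv psi A then #|A|%:Z else 0)) => [|x _].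
    by rewrite -big_mkcond sumr_const -mulr_natr natz.
  rewrite sum_chi_linear; last exact: (alt_psi.1.1 x).
  by congr (if _ then _ else _); apply/forall_inP/memv_perp => // A0 y Ay; apply/eqP/A0.
rewrite -dbl (eq_bigr (fun a : V => if a \in radv psi then #|(fullv : {vspace V})|%:Z else 0)) => [|a _].
  rewrite -big_mkcondr sumr_const -mulr_natr natz; congr (_ * Posz _).
  by apply: eq_card => x; rewrite memv_cap.
rewrite (eq_bigl (mem (fullv : {vspace V}))) => [|y]; last by rewrite /= memvf.
rewrite sum_chi_linear; last exact: (alt_psi.1.2 a).
congr (if _ then _ else _); apply/forall_inP/(memv_radv _ alt_psi) => [a0 y | a0 y _].
  by apply/eqP/a0; rewrite memvf.
by rewrite a0.
Qed.

Lemma notin_perp psi A x : alternating_form psi ->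
  x \notin perpv psi A -> exists2 y, y \in A & psi y x != 0.
Proof.
move=> alt_psi nAx; have [/exists_inP[y Ay yx] | /exists_inPn A0] :=
  boolP [exists y in (A : {pred V}), psi y x != 0]; first by exists y.
case/negP: nAx; apply/memv_perp => // y Ay.
by have := A0 y Ay; rewrite negbK => /eqP.
Qed.

Lemma dim_add_line U x : x \notin U -> \dim (<[x]> + U) = (\dim U).+1.
Proof.
move=> nUx; rewrite dimv_disjoint_sum ?dim_vline.
  by case: eqP nUx => // ->; rewrite mem0v.
apply/eqP; rewrite -subv0; apply/subvP => y.
rewrite memv_cap memv0 => /andP[/vlineP[a ->]].
case: (eqVneq a 0) => [-> | a_neq0]; first by rewrite scale0r.
by rewrite rpredZeq (negbTE nUx) (negbTE a_neq0).
Qed.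

Lemma dim_cap_perp_pair psi U a b : alternating_form psi ->
  a \in U -> b \in U -> psi a b != 0 ->
  (\dim (U :&: perpv psi (<[a]> + <[b]>))).+2 = \dim U.
Proof.
move=> alt_psi Ua Ub ab; rewrite perpD // capvA.
have Wa : a \in (U :&: perpv psi <[a]>)%VS by rewrite memv_cap Ua memv_perp_line // altxx ?eqxx.
have ba : psi b a != 0 by rewrite altC // oppr_eq0.
by rewrite (dim_cap_perp_line alt_psi Wa ba) (dim_cap_perp_line alt_psi Ub ab).
Qed.

Lemma cap_perp_pair psi U a b : alternating_form psi ->
  a \in U -> b \in U -> psi a b != 0 ->
  (<[a]> + <[b]> + (U :&: perpv psi (<[a]> + <[b]>)) = U)%VS
  /\ ((<[a]> + <[b]>) :&: perpv psi (<[a]> + <[b]>) = 0)%VS.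
Proof.
move=> alt_psi Ua Ub ab; set P := (<[a]> + <[b]>)%VS.
have sPU : (P <= U)%VS by rewrite subv_add -!memvE Ua Ub.
have dimP : \dim P = 2.
  rewrite dim_add_line ?dim_vline; last first.
    by apply: contra ab => /vlineP[c ->]; rewrite altZl // altxx // mulr0.
  by case: (eqVneq b 0) ab => // ->; rewrite alt0r // eqxx.
have Pa : a \in P by rewrite memvE addvSl.
have Pb : b \in P by rewrite memvE addvSr.
have P0 : (P :&: perpv psi P = 0)%VS.
  have := dim_cap_perp_pair alt_psi Pa Pb ab; rewrite dimP => /eqP.
  by rewrite !eqSS dimv_eq0 => /eqP.
split=> //; apply/eqP; rewrite eqEdim subv_add sPU capvSl /=.
rewrite dimv_disjoint_sum ?dimP ?add2n ?dim_cap_perp_pair //.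
by apply/eqP; rewrite -subv0 -P0 capvS ?capvSr.
Qed.

(** Alternating forms have even rank: splitting off a plane [P] on which psi is non-degenerate
    lowers the dimension by 2 and leaves the radical of U unchanged. *)
Lemma odd_dim_radical psi U : alternating_form psi ->
  odd (\dim (U :&: perpv psi U)) = odd (\dim U).
Proof.
move=> alt_psi; move: {2}(\dim U) (leqnn (\dim U)) => k; elim: k U => [|k IHk] U.
  by rewrite leqn0 dimv_eq0 => /eqP->; rewrite cap0v.
move=> leUk; have [sUU | /subvPn[b Ub]] := boolP (U <= perpv psi U)%VS.
  by rewrite (capv_idPl sUU).
case/(notin_perp alt_psi) => a Ua ab.
set P := (<[a]> + <[b]>)%VS; set W := (U :&: perpv psi P)%VS.
have dimW : (\dim W).+2 = \dim U by apply: dim_cap_perp_pair.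
have [defU _] := cap_perp_pair alt_psi Ua Ub ab.
rewrite -dimW /= negbK -(IHk W); last by move: leUk; rewrite -dimW ltnS => /ltnW.
congr (odd (\dim _)); apply/eqP; rewrite eqEsubv; apply/andP; split.
  apply/subvP => x; rewrite !memv_cap => /andP[Ux Px]; rewrite Ux.
  have sPU : (P <= U)%VS by rewrite subv_add -!memvE Ua Ub.
  rewrite (subvP (perpS alt_psi sPU)) //=.
  by rewrite (subvP (perpS alt_psi (capvSl U _))).
apply/subvP => x; rewrite !memv_cap => /andP[/andP[Ux Px] Wx]; rewrite Ux /=.
have UPW : x \in perpv psi (P + W) by rewrite perpD // memv_cap Px.
by move: UPW; rewrite {1}defU.
Qed.

End CharacterSums.
End PerpSpaces.

(** * Gauss sums of quadratic forms *)

Section QuadraticGaussSums.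
Variables (F : finFieldType) (V0 : vectType F) (e : nat).
Local Notation V := (finvect_type V0).
Hypothesis card_F : #|F| = (2 ^ e)%N.
Variable eta : V -> F.
Hypothesis quad_eta : quadratic_form eta.
Implicit Types (a b u w x y z : V) (A B J U : {vspace V}).
Local Notation q := (#|F|%:Z).
Local Notation chi := (chi e).
Local Notation beta := (polar eta).

Lemma quadZ (c : F) x : eta (c *: x) = c ^+ 2 * eta x.
Proof. exact: quad_eta.1. Qed.

Lemma quadD x y : eta (x + y) = eta x + eta y + beta x y.
Proof. by rewrite /polar; ring. Qed.

Lemma quad0 : eta 0 = 0.
Proof. by rewrite -(scale0r 0) quadZ expr0n mul0r. Qed.

Lemma alternating_polar : alternating_form beta.
Proof.
split=> [|x]; first exact: quad_eta.2.
rewrite /polar -[x in x + x]scale1r -scalerDl (addrr_pchar2 (pchar2_of_card card_F)) scale0r.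
by rewrite quad0 sub0r -opprD (addrr_pchar2 (pchar2_of_card card_F)) oppr0.
Qed.
Let alt_beta : alternating_form beta := alternating_polar.

Definition gauss_sum U : int := \sum_(y in U) chi (eta y).
Local Notation G := gauss_sum.

(** Translating by s w, with w in the radical of U, adds the constant s^2 eta w to eta; since every
    element is a square, s can be chosen to give this constant character -1. *)
Lemma gauss_sum_eq0 U w :
  w \in U -> w \in perpv beta U -> eta w != 0 -> G U = 0.
Proof.
move=> Uw /memv_perp-/(_ alt_beta) w0 eta_w; have [c chi_c] := chi_eqN1 card_F.
have [s s2] := sqr_root card_F (c / eta w).
apply: (sum_chi_shift card_F (w := s *: w)) => [|y Uy]; first by rewrite rpredZ.
rewrite quadD quadZ -s2 divfK // (altZr alt_beta) w0 // mulr0 addr0.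
by rewrite chiD // chi_c mulrN1.
Qed.

(** Write the second variable as y + h. In characteristic 2, eta y + eta (y + h) = eta h + beta y h,
    and the sum over y keeps only the h orthogonal to U. *)
Lemma gauss_sum_sqr U :
  G U ^+ 2 = #|U|%:Z * \sum_(h in (U :&: perpv beta U)%VS) chi (eta h).
Proof.
rewrite expr2 {1}/gauss_sum big_distrl /=.
transitivity (\sum_(y in U) \sum_(h in U) chi (eta h) * chi (beta y h)).
  apply: eq_bigr => y Uy; rewrite /gauss_sum mulr_sumr (reindex_inj (addrI y)) /=.
  apply: eq_big => h; first by rewrite rpredDl.
  by move=> _; rewrite quadD (chiD card_F (_ + _)) (chiD card_F (eta y)) !mulrA chi_mulxx // mul1r.
rewrite exchange_big mulr_sumr /=.
rewrite [RHS](eq_bigl (fun h => (h \in U) && (h \in perpv beta U))); last first.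
  by move=> h; rewrite memv_cap.
rewrite [RHS]big_mkcondr; apply: eq_bigr => h Uh.
rewrite -mulr_sumr (sum_chi_linear card_F U (alt_beta.1.1 h)) mulrC.
have -> : [forall y in U, beta y h == 0] = (h \in perpv beta U).
  apply/forall_inP/memv_perp => [|h0|h0 y Uy]; first exact: alt_beta.
    by move=> y Uy; apply/eqP/h0.
  exact/eqP/h0.
by case: ifP; rewrite ?mul0r.
Qed.

Lemma gauss_sum_sqr_singular U :
  (forall h, h \in U -> h \in perpv beta U -> eta h = 0) ->
  G U ^+ 2 = q ^+ (\dim U + \dim (U :&: perpv beta U)).
Proof.
move=> sing; rewrite gauss_sum_sqr (eq_bigr (fun _ => 1)); last first.
  by move=> h; rewrite memv_cap => /andP[Uh ph]; rewrite sing // chi0.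
by rewrite sumr_const natz !card_vspaceE exprD; congr (_ * _); rewrite -natz natrX natz.
Qed.

Lemma gauss_sum_singular U : (forall h, h \in U -> eta h = 0) -> G U = #|U|%:Z.
Proof.
move=> sing; rewrite /gauss_sum (eq_bigr (fun _ => 1)).
  by rewrite sumr_const natz.
by move=> y Uy; rewrite sing // chi0.
Qed.

(** Orthogonality applied to eta. Each c <> 0 contributes the same [G U]: writing c = s^2, the
    factor c is absorbed by rescaling the vectors by s. *)
Lemma card_singular U :
  q * #|[pred y in U | eta y == 0]|%:Z = #|U|%:Z + (q - 1) * G U.
Proof.
have <-: \sum_(y in U) \sum_c chi (c * eta y) = q * #|[pred y in U | eta y == 0]|%:Z.
  rewrite (eq_bigr _ (fun y _ => sum_chiM card_F (eta y))) -big_mkcondr sumr_const.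
  by rewrite -mulr_natr natz; congr (_ * _).
rewrite exchange_big (bigD1 0) //=; congr (_ + _).
  rewrite (eq_bigr (fun _ => 1)) => [|y Uy]; first by rewrite sumr_const natz.
  by rewrite mul0r chi0.
rewrite (eq_bigr (fun _ => G U)) => [|c c_neq0]; last first.
  have [s def_c] := sqr_root card_F c.
  have s_neq0 : s != 0 by apply: contra c_neq0 => /eqP s0; rewrite def_c s0 expr0n.
  rewrite /gauss_sum [RHS](reindex_inj (scalerI s_neq0)) /=; apply: eq_big => y.
    by rewrite rpredZeq (negbTE s_neq0).
  by move=> _; rewrite quadZ -def_c.
exact: sum_neq_const.
Qed.

Lemma gauss_sumD A B : (A <= perpv beta B)%VS -> (A :&: B = 0)%VS ->
  G (A + B)%VS = G A * G B.
Proof.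
move=> sAB AB0; rewrite /gauss_sum mulr_suml.
under [RHS]eq_bigr do rewrite mulr_sumr.
rewrite pair_big_dep /=.
rewrite (reindex_onto (fun p : V * V => p.1 + p.2)
  (fun x => (daddv_pi A B x, daddv_pi B A x))) /=; last first.
  by move=> x ABx; rewrite daddv_pi_add.
have BA0 : (B :&: A = 0)%VS by rewrite capvC.
apply: eq_big => [[a b] | [a b]] /=.
  apply/andP/andP => [[AB /eqP[<- <-]] | [Aa Bb]]; first by rewrite !memv_pi.
  rewrite memv_add //; split=> //; apply/eqP.
  have pi0 C D x : (C :&: D = 0)%VS -> x \in D -> daddv_pi C D x = 0.
    move=> CD0 Dx; have := daddv_pi_add CD0 (subvP (addvSr C D) x Dx).
    by rewrite (daddv_pi_id _ Dx) 1?capvC // => /(canRL (addrK x)); rewrite subrr.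
  rewrite !linearD /= (daddv_pi_id AB0 Aa) (daddv_pi_id BA0 Bb).
  by rewrite !pi0 // addr0 add0r.
move=> /andP[AB /eqP[def_a def_b]].
have Aa : a \in A by rewrite -def_a memv_pi.
have Bb : b \in B by rewrite -def_b memv_pi.
have /memv_perp-/(_ alt_beta) perpB := subvP sAB _ Aa.
by rewrite quadD (altC alt_beta) perpB // oppr0 addr0 chiD.
Qed.

(** Translation by t a multiplies chi (eta y) by chi (t * beta a y); averaging over t removes every
    y not orthogonal to a. *)
Lemma gauss_sum_cap_perp U a : a \in U -> eta a = 0 ->
  G U = G (U :&: perpv beta <[a]>)%VS.
Proof.
move=> Ua eta_a; apply: (mulfI (lt0r_neq0 (card_field_gt0 F))).
transitivity (\sum_(t : F) \sum_(y in U) chi (eta y) * chi (t * beta a y)).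
  rewrite -[q]natz mulr_natl -sumr_const; apply: eq_bigr => t _.
  rewrite /gauss_sum (reindex_inj (addIr (t *: a))) /=; apply: eq_big => y.
    by rewrite rpredDr // memvZ.
  move=> _; rewrite quadD quadZ eta_a mulr0 addr0 (altZr alt_beta).
  by rewrite (chiD card_F (eta y)) (altC alt_beta y a) (oppr_pchar2 (pchar2_of_card card_F)).
rewrite exchange_big /gauss_sum mulr_sumr [RHS](eq_bigl (fun y => (y \in U) && (beta a y == 0))).
  rewrite [RHS]big_mkcondr; apply: eq_bigr => y Uy.
  by rewrite -mulr_sumr (sum_chiM card_F) mulrC; case: ifP; rewrite ?mul0r.
by move=> y; rewrite memv_cap memv_perp_line.
Qed.

Lemma gauss_sum_line a : eta a = 0 -> a != 0 -> G <[a]>%VS = q.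
Proof.
move=> eta_a a0; rewrite (gauss_sum_singular) => [|_ /vlineP[t ->]].
  by rewrite card_vspace_exp dim_vline a0 expr1.
by rewrite quadZ eta_a mulr0.
Qed.

Lemma hyperbolic_partner U a : a \in U -> a \notin perpv beta U -> eta a = 0 ->
  exists b, [/\ b \in U, eta b = 0 & beta a b = 1].
Proof.
move=> Ua na eta_a; have [b' Ub' ba] := notin_perp alt_beta na.
have ab : beta a b' != 0 by rewrite altC_eq0.
pose b1 := (beta a b')^-1 *: b'.
have ab1 : beta a b1 = 1 by rewrite (altZr alt_beta) mulVf.
have Ub1 : b1 \in U by rewrite memvZ.
(* Adding t a to b1 keeps [beta a b1 = 1] and changes [eta b1] by -t, so t = eta b1 gives a singular
   vector. *)
move: b1 ab1 Ub1 => b1 ab1 Ub1; exists (b1 + eta b1 *: a); split.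
- by rewrite rpredD ?memvZ.
- rewrite quadD quadZ eta_a mulr0 addr0 (altZr alt_beta).
  by rewrite (altC alt_beta a b1) ab1 mulrN1 subrr.
- by rewrite (altDr alt_beta) (altZr alt_beta) (altxx alt_beta) mulr0 addr0.
Qed.

(** The perp of a in J is the orthogonal sum of <a>, whose Gauss sum is q, and of the complement of
    the hyperbolic plane. *)
Lemma hyperbolic_split J a b : a \in J -> b \in J -> eta a = 0 -> beta a b = 1 ->
  G J = q * G (J :&: perpv beta (<[a]> + <[b]>))%VS.
Proof.
move=> Ja Jb eta_a ab; have ab_neq0 : beta a b != 0 by rewrite ab oner_eq0.
have a0 : a != 0 by apply: contraNneq ab_neq0 => ->; rewrite alt0l.
set W := (J :&: _)%VS; rewrite (gauss_sum_cap_perp Ja) // -(gauss_sum_line eta_a a0).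
have sWa : (<[a]> <= perpv beta W)%VS.
  by rewrite sub_perpC // (subv_trans (capvSr _ _)) // perpS ?addvSl.
have na : a \notin W.
  rewrite memv_cap negb_and; apply/orP; right; apply/negP => /(memv_perp _ _ alt_beta) Pa.
  have := Pa b; rewrite memvE addvSr => /(_ isT) /eqP; rewrite altC_eq0 //.
  exact/negP.
rewrite -(gauss_sumD sWa); last first.
  apply/eqP; rewrite -subv0; apply/subvP => x; rewrite memv_cap memv0 => /andP[/vlineP[t ->]].
  by rewrite rpredZeq (negbTE na) orbF => /eqP->; rewrite scale0r.
congr (G _); apply/eqP; rewrite eq_sym eqEdim subv_add; apply/andP; split.
  rewrite -memvE memv_cap Ja memv_perp_line // (altxx alt_beta) eqxx /=.
  by rewrite capvS // perpS // addvSl.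
rewrite dim_add_line // -ltnS (dim_cap_perp_line card_F alt_beta Jb ab_neq0).
by rewrite (dim_cap_perp_pair card_F alt_beta Ja Jb ab_neq0).
Qed.

Lemma nondeg_cap_perp_pair J a b : (J :&: perpv beta J = 0)%VS ->
  a \in J -> b \in J -> beta a b != 0 -> let W := (J :&: perpv beta (<[a]> + <[b]>))%VS in
  (W :&: perpv beta W = 0)%VS.
Proof.
move=> J0 Ja Jb ab W; apply/eqP; rewrite -subv0 -J0; apply/subvP => x.
rewrite !memv_cap => /andP[/andP[Jx Px] Wx]; rewrite Jx /=.
have [defJ _] := cap_perp_pair card_F alt_beta Ja Jb ab.
suff: x \in perpv beta (<[a]> + <[b]> + W) by rewrite defJ.
by rewrite perpD // memv_cap Px.
Qed.

(** The sign of the Gauss sum distinguishes hyperbolic from elliptic forms. A positive sum forces a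
    nonzero singular vector, hence a hyperbolic plane, and splitting this plane off divides the sum
    by q without changing its sign. *)
Lemma hyperbolic_basis k J : \dim J = k.*2 -> (J :&: perpv beta J = 0)%VS -> 0 < G J ->
  exists s : seq V, [/\ size s = k.*2, (<<s>> = J)%VS
    & forall c : nat -> F, eta (\sum_(i < k.*2) c i *: s`_i) = \sum_(j < k) c j.*2 * c j.*2.+1].
Proof.
elim: k J => [|k IHk] J dimJ J0 GJ.
  exists [::]; split=> // [|c]; last by rewrite !big_ord0 quad0.
  by apply/esym/eqP; rewrite span_nil -dimv_eq0 dimJ.
have [a [Ja a0 eta_a]] : exists a, [/\ a \in J, a != 0 & eta a = 0].
  have cardJ := card_singular J.
  rewrite (cardD1 0 [pred y in J | eta y == 0]) inE mem0v quad0 eqxx card_vspace_exp dimJ doubleS in cardJ.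
  have : (0 < #|[predD1 [pred y in J | eta y == 0%R] & 0%R]|)%N.
    rewrite lt0n; apply/negP => /eqP S0; rewrite S0 addn0 mulr1 in cardJ.
    (* If 0 were the only singular vector, the right-hand side would equal q. *)
    have : q < q ^+ k.*2.+2 + (q - 1) * G J.
      have := ler_weXn2l (le_trans (isT : 1 <= 2 :> int) (card_field_ge2 F)) (isT : (1 <= k.*2.+2)%N).
      rewrite expr1; move/le_lt_trans; apply; rewrite ltrDl mulr_gt0 //.
      by rewrite subr_gt0 (lt_le_trans _ (card_field_ge2 F)).
    by rewrite -cardJ ltxx.
  case/card_gt0P => a; rewrite !inE => /and3P[a0 Ja /eqP eta_a].
  by exists a.
have na : a \notin perpv beta J.
  by apply: contra a0 => Pa; rewrite -memv0 -J0 memv_cap Ja.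
have [b [Jb eta_b ab]] := hyperbolic_partner Ja na eta_a.
have ab_neq0 : beta a b != 0 by rewrite ab oner_eq0.
set W := (J :&: perpv beta (<[a]> + <[b]>))%VS.
have dimW : \dim W = k.*2.
  by have := dim_cap_perp_pair card_F alt_beta Ja Jb ab_neq0; rewrite dimJ doubleS => -[].
have GW : 0 < G W.
  by move: GJ; rewrite (hyperbolic_split Ja Jb eta_a ab) pmulr_rgt0 // card_field_gt0.
have [s [size_s span_s eta_s]] := IHk W dimW (nondeg_cap_perp_pair J0 Ja Jb ab_neq0) GW.
have [defJ _] := cap_perp_pair card_F alt_beta Ja Jb ab_neq0.
exists [:: a, b & s]; split=> [||c]; first by rewrite /= size_s doubleS.
  by rewrite !span_cons span_s addvA.
rewrite doubleS !big_ord_recl /= addrA quadD.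
set z := \sum_(i < k.*2) _; have Wz : z \in W.
  apply: rpred_sum => i _; rewrite memvZ // -span_s memv_span //=.
  by rewrite add0n mem_nth // size_s ltn_ord.
have -> : eta z = \sum_(j < k) c j.*2.+2 * c j.*2.+3 by apply: (eta_s (fun i => c i.+2)).
have /(memv_perp _ _ alt_beta) Pz : z \in perpv beta (<[a]> + <[b]>) by move: Wz; rewrite memv_cap => /andP[].
rewrite Pz ?addr0; last by rewrite memv_add ?memvZ ?memv_line.
rewrite quadD !quadZ eta_a eta_b !mulr0 !add0r.
by rewrite (altZl alt_beta) (altZr alt_beta) ab mulr1.
Qed.

End QuadraticGaussSums.

(** * The nucleus and the weight of a pencil *)

Section Nucleus.
Variables (F : finFieldType) (V0 : vectType F) (e n : nat).
Local Notation V := (finvect_type V0).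
Hypothesis card_F : #|F| = (2 ^ e)%N.
Variable eta : V -> F.
Hypothesis nondeg_eta : nondegenerate_quadratic_form eta.
Hypothesis dim_V : (\dim (fullv : {vspace V}) = n.*2.+1)%N.
Implicit Types (u w x y z : V) (A B U : {vspace V}).
Local Notation q := (#|F|%:Z).
Local Notation chi := (chi e).
Local Notation beta := (polar eta).
Local Notation G := (gauss_sum e eta).

Let quad_eta : quadratic_form eta := nondeg_eta.1.
Let alt_beta : alternating_form beta := alternating_polar card_F quad_eta.

(** The dimension of the radical is odd like that of V, so it is nonzero. Scaling by a square root
    gives eta r = 1; any other radical vector y differs from t r, where t^2 = eta y, by a singular
    radical vector, which is 0. *)
Lemma nucleus_exists : exists2 r, eta r = 1 & radv beta = <[r]>%VS.
Proof.
have : odd (\dim (radv beta)).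
  have := odd_dim_radical card_F fullv alt_beta.
  by rewrite capfv dim_V /= odd_double.
move=> odd_rad; have rad_neq0 : radv beta != 0%VS.
  by apply: contraTneq odd_rad => ->; rewrite dimv0.
pose r0 := vpick (radv beta).
have r0_rad : r0 \in radv beta := memv_pick _.
have r0_neq0 : r0 != 0 by rewrite vpick0.
have r0_perp y : beta r0 y = 0 by apply/memv_radv: y.
have eta_r0 : eta r0 != 0.
  by apply: contra r0_neq0 => /eqP eta0; apply/eqP/(nondeg_eta.2 r0 r0_perp).
have [s s2] := sqr_root card_F (eta r0)^-1.
exists (s *: r0); first by rewrite (quadZ quad_eta) -s2 mulVf.
have s_neq0 : s != 0.
  by apply: contraNneq eta_r0 => s0; rewrite -invr_eq0 s2 s0 expr0n.
apply/eqP; rewrite eqEsubv -[(<[_]> <= _)%VS]memvE memvZ // andbT.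
apply/subvP => y /(memv_radv _ alt_beta) y0.
have [t t2] := sqr_root card_F (eta y).
suff /eqP: y - t *: (s *: r0) = 0.
  by rewrite subr_eq0 => /eqP->; rewrite memvZ ?memv_line.
apply: nondeg_eta.2 => [z|].
  by rewrite -scaleN1r (altDl alt_beta) !(altZl alt_beta) y0 r0_perp !mulr0 addr0.
rewrite -scaleN1r (quadD eta) !(quadZ quad_eta) y0 addr0 -s2 mulVf // mulr1 t2.
by rewrite sqrrN expr1n mul1r (addrr_pchar2 (pchar2_of_card card_F)).
Qed.

Variable r : V.
Hypothesis eta_r : eta r = 1.
Hypothesis rad_r : radv beta = <[r]>%VS.

Let N : int := q ^+ n.*2.+1.

Lemma nucleus_perp y : beta r y = 0.
Proof. by apply/(memv_radv _ alt_beta): y; rewrite rad_r memv_line. Qed.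

Lemma nucleus_in_perp U : r \in perpv beta U.
Proof. by apply/(memv_perp _ _ alt_beta) => y _; rewrite (altC alt_beta) nucleus_perp oppr0. Qed.

Lemma nucleus_neq0 : r != 0.
Proof. by apply: contra_eq_neq eta_r => ->; rewrite (quad0 quad_eta) eq_sym oner_eq0. Qed.

Lemma gauss_sum_nucleus U : r \in U -> G U = 0.
Proof.
by move=> Ur; apply: (gauss_sum_eq0 card_F quad_eta Ur (nucleus_in_perp U)); rewrite eta_r oner_eq0.
Qed.

Lemma dim_perp_nucleus U : r \notin U ->
  (\dim U + \dim (perpv beta U) = n.*2.+1)%N.
Proof.
move=> nUr; rewrite (dim_perp card_F) // dim_V -[RHS]addn0; congr (_ + _)%N.
apply/eqP; rewrite dimv_eq0 -subv0; apply/subvP => x.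
rewrite memv_cap rad_r memv0 => /andP[Ux /vlineP[a def_x]]; rewrite def_x.
by move: Ux; rewrite def_x rpredZeq (negbTE nUr) orbF => /eqP->; rewrite scale0r.
Qed.

(** U lies in the perp of its own radical, and strictly so, because that perp contains r. *)
Lemma dim_radical_bound U : r \notin U -> (\dim U + \dim (U :&: perpv beta U) <= n.*2)%N.
Proof.
move=> nUr; set R := (U :&: _)%VS.
have nRr : r \notin R by rewrite memv_cap (negbTE nUr).
have sUR : (U <= perpv beta R)%VS by rewrite sub_perpC // capvSr.
have ltU : (\dim U < \dim (perpv beta R))%N.
  rewrite ltn_neqAle dimvS // andbT (dimv_leqif_eq sUR).
  by apply: contra nUr => /eqP->; apply: nucleus_in_perp.
by have := dim_perp_nucleus nRr; lia.
Qed.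

(** Either the radical of U contains a non-singular vector and the sum is 0, or its square is q to
    the sum of the dimensions of U and of its radical. *)
Lemma gauss_sum_le U : r \notin U -> G U <= q ^+ n.
Proof.
move=> nUr; have qn_ge0 : 0 <= q ^+ n by rewrite exprn_ge0.
have [/exists_inP[w] | /exists_inPn sing] :=
  boolP [exists w in (U :&: perpv beta U)%VS, eta w != 0].
  by rewrite memv_cap => /andP[Uw pw] /(gauss_sum_eq0 card_F quad_eta Uw pw)->.
have le2 : G U ^+ 2 <= (q ^+ n) ^+ 2.
  rewrite (gauss_sum_sqr_singular card_F) // => [|h Uh ph]; last first.
    by apply/eqP; have := sing h; rewrite memv_cap Uh ph negbK; apply.
  by rewrite -exprM muln2 ler_weXn2l ?dim_radical_bound // (le_trans _ (card_field_ge2 F)).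
have [/ltW|G_ge0] := ltP (G U) 0; first by move/le_trans; apply.
by move: le2; rewrite ler_pXn2r ?nnegrE.
Qed.
Lemma card_perpv_line psi x : alternating_form psi ->
  q * #|perpv psi <[x]>%VS|%:Z = if x \in radv psi then q * N else N.
Proof.
move=> alt_psi; case: ifP => [/(memv_radv _ alt_psi) x0 | /negbT nx].
  have -> : perpv psi <[x]> = fullv.
    by apply/vspaceP => y; rewrite memvf memv_perp_line // x0 eqxx.
  by rewrite card_vspace_exp dim_V.
have [y _ yx] := notin_perp alt_psi nx.
have xy : psi x y != 0 by rewrite altC_eq0.
have := dim_cap_perp_line card_F alt_psi (memvf y) xy.
by rewrite capfv card_vspace_exp -exprS => ->; rewrite dim_V.
Qed.

(** * Double counting of singular pairs over the pencil *)

Section CountingSingularPairs.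
Variable phi : V -> V -> F.
Hypothesis alt_phi : alternating_form phi.
Local Notation psi := (pencil phi beta).
Let alt_psi l : alternating_form (psi l) := alternating_pencil l alt_phi alt_beta.
Let W x : {vspace V} := (perpv beta <[x]> :&: perpv phi <[x]>)%VS.

(** If beta x y <> 0, only l = phi x y / beta x y makes the pencil vanish at (x, y); otherwise l has
    no influence. *)
Lemma card_pencil_eq0 x y :
  \sum_l (psi l x y == 0)%:Z
  = 1 - (beta x y == 0)%:Z + q * ((beta x y == 0) && (phi x y == 0))%:Z.
Proof.
rewrite /pencil; case: (eqVneq (beta x y) 0) => [-> | bxy] /=.
  under eq_bigr do rewrite mulr0 subr0.
  rewrite sumr_const -mulr_natr natz mulrC subrr add0r; congr (_ * _).
rewrite (bigD1 (phi x y / beta x y)) //= divfK // subrr eqxx big1 => [|l ne_l].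
  by rewrite mulr0; lia.
by rewrite subr_eq0; case: eqP => // def_phi; rewrite def_phi mulfK ?eqxx // in ne_l.
Qed.

(** Trades a sum over the common perp [W x], defined by two forms, for sums over the perp of a
    single form. *)
Lemma sum_pencil_perp (h : V -> int) x :
  \sum_l \sum_(y in perpv (psi l) <[x]>%VS) h y
  = \sum_(y : V) h y - \sum_(y in perpv beta <[x]>%VS) h y + q * \sum_(y in W x) h y.
Proof.
have indic (P : pred V) (A : {vspace V}) : (forall y, (y \in A) = P y) ->
    \sum_(y in A) h y = \sum_(y : V) (P y)%:Z * h y.
  move=> PA; rewrite big_mkcond; apply: eq_bigr => y _.
  by rewrite PA; case: (P y); rewrite ?mul1r ?mul0r.
under eq_bigr => l _ do rewrite (indic _ _ (fun y => memv_perp_line x y (alt_psi l))).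
rewrite exchange_big (indic _ _ (fun y => memv_perp_line x y alt_beta)).
rewrite (indic (fun y => (beta x y == 0) && (phi x y == 0))); last first.
  by move=> y; rewrite memv_cap !memv_perp_line.
rewrite mulr_sumr -sumrB -big_split; apply: eq_bigr => y _ /=.
by rewrite -mulr_suml card_pencil_eq0; ring.
Qed.

(* Both sides come from summing over the triples (l, x, y) with
   psi l x y = 0 the weight chi (eta y): on the left x is summed last, on the
   right l and y. *)
Lemma sum_gauss_sum_common_perp :
  q ^+ 2 * \sum_(x : V | eta x == 0) G (W x) = (q - 1) * N * \sum_l G (radv (psi l)).
Proof.
have full0 : \sum_(y : V) chi (eta y) = 0.
  rewrite -[RHS](gauss_sum_nucleus (memvf r)); apply: eq_bigl => y.
  by rewrite memvf.
(* A non-singular x is itself a radical vector of [W x]; hence the sum over singular x may be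
   extended to all x, which makes the exchange of variables possible. *)
have W0 x : eta x != 0 -> G (W x) = 0.
  move=> eta_x; apply: (gauss_sum_eq0 card_F quad_eta (w := x)) => //.
    by rewrite memv_cap !memv_perp_line // !altxx // eqxx.
  apply/(memv_perp _ _ alt_beta) => y; rewrite memv_cap !memv_perp_line //.
  by case/andP => /eqP xy _; rewrite (altC alt_beta) xy oppr0.
have -> : \sum_(x : V | eta x == 0) G (W x) = \sum_(x : V) G (W x).
  rewrite big_mkcond; apply: eq_bigr => x _; case: ifPn => // /W0-> //.
have sumW : q * \sum_(x : V) G (W x)
    = \sum_(x : V) \sum_l \sum_(y in perpv (psi l) <[x]>%VS) chi (eta y).
  rewrite mulr_sumr; apply: eq_bigr => x _.
  rewrite (sum_pencil_perp (fun y => chi (eta y))) full0.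
  by rewrite [X in - X](gauss_sum_nucleus (nucleus_in_perp _)) subrr add0r.
rewrite expr2 -mulrA sumW exchange_big !mulr_sumr; apply: eq_bigr => l _ /=.
have -> : \sum_(x : V) \sum_(y in perpv (psi l) <[x]>%VS) chi (eta y)
    = \sum_(y : V) #|perpv (psi l) <[y]>%VS|%:Z * chi (eta y).
  rewrite (exchange_big_dep predT) //=; apply: eq_bigr => y _.
  rewrite sumr_const -mulr_natl natz; congr (Posz _ * _).
  apply: eq_card => x; transitivity (y \in perpv (psi l) <[x]>%VS); first by [].
  by rewrite !memv_perp_line // altC_eq0.
rewrite mulr_sumr (eq_bigr (fun y : V => N * chi (eta y)
    + (if y \in radv (psi l) then (q - 1) * N * chi (eta y) else 0))).
  rewrite big_split /= -mulr_sumr full0 mulr0.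
  by rewrite add0r -big_mkcond -mulr_sumr.
move=> y _; rewrite mulrA card_perpv_line //; case: ifP => _; ring.
Qed.

(** This is [sum_pencil_perp] for h = 1. The only singular vector in the radical of beta is 0,
    whence the [- 1] in the last term. *)
Lemma sum_card_common_perp (sing := [pred x : V | eta x == 0]) :
  q ^+ 2 * \sum_(x in sing) #|W x|%:Z
  = q * N * #|sing|%:Z + (q - 1) * N * \sum_l #|[pred x in radv (psi l) | eta x == 0]|%:Z
    - (#|sing|%:Z - 1) * (q - 1) * N.
Proof.
have sumW x : q ^+ 2 * #|W x|%:Z = \sum_l (N + (if x \in radv (psi l) then (q - 1) * N else 0))
    - (if x \in radv beta then 0 else (q - 1) * N).
  have := sum_pencil_perp (fun _ => 1) x; rewrite !sumr_const.
  under eq_bigr do rewrite sumr_const natz.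
  rewrite !natz => /(congr1 ( *%R q)); rewrite mulr_sumr.
  rewrite (eq_bigr (fun l => N + (if x \in radv (psi l) then (q - 1) * N else 0))); last first.
    by move=> l _; rewrite card_perpv_line //; case: ifP => _; ring.
  move=> ->; have := card_perpv_line x alt_beta.
  have -> : #|V|%:Z = N.
    by rewrite -[N]/(q ^+ n.*2.+1) -dim_V -card_vspace_exp; congr Posz; apply: eq_card => y; rewrite memvf.
  by case: ifP => _; rewrite mulrDr mulrBr => ->; ring.
rewrite mulr_sumr (eq_bigr _ (fun x _ => sumW x)) sumrB; congr (_ - _).
  rewrite exchange_big /=.
  under eq_bigr => l _.
    rewrite big_split /= sumr_const -mulr_natl natz -big_mkcondr sumr_const -mulr_natl natz; over.
  rewrite big_split /= sumr_const -mulr_natl natz -mulr_suml; congr (_ + _); first ring.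
  rewrite mulrC; congr (_ * _); apply: eq_bigr => l _; congr Posz.
  by apply: eq_card => x; rewrite !inE andbC.
rewrite (bigD1 0) /=; last by rewrite inE (quad0 quad_eta).
rewrite mem0v add0r (eq_bigr (fun _ => (q - 1) * N)) => [|x].
  rewrite sumr_const -mulr_natl natz mulrA; congr (_ * _ * _).
  rewrite (cardD1 0 sing) !inE (quad0 quad_eta) eqxx /= PoszD addrC addKr.
  by congr Posz; apply: eq_card => x; rewrite !inE andbC.
rewrite inE rad_r => /andP[/eqP eta_x x_neq0]; case: ifP => // /vlineP[a def_x].
move: eta_x; rewrite def_x (quadZ quad_eta) eta_r mulr1 => /eqP.
by rewrite expf_eq0 /= => /eqP a0; rewrite def_x a0 scale0r eqxx in x_neq0.
Qed.

(* This is the quantity Theta. *)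
Definition pencil_weight : int :=
  \sum_l (q ^+ \dim (radv (psi l)) + (q ^+ 2 - 1) * G (radv (psi l))).

(** For a singular x, the admissible y are the singular vectors orthogonal to x under beta but
    outside [W x]. Both sets are counted through their size and Gauss sum, and the first Gauss sum
    vanishes because r is orthogonal to everything. Powers of q clear the denominators. *)
Lemma card_singular_pairs :
  q ^+ 4 * #|[pred p : V * V | [&& eta p.1 == 0, eta p.2 == 0,
                               beta p.1 p.2 == 0 & phi p.1 p.2 != 0]]|%:Z
  = (q - 1) * N * (q ^+ 2 + N - q - pencil_weight).
Proof.
set P := (X in _ * X = _); pose sing := [pred x : V | eta x == 0].
pose S1 : int := \sum_(x in sing) #|perpv beta <[x]>%VS|%:Z.
pose S2 : int := \sum_(x in sing) #|W x|%:Z.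
pose S3 : int := \sum_(x in sing) G (W x).
pose K : int := \sum_l #|[pred x in radv (psi l) | eta x == 0]|%:Z.
pose D : int := \sum_l #|radv (psi l)|%:Z.
pose R : int := \sum_l G (radv (psi l)).
have defT : pencil_weight = D + (q ^+ 2 - 1) * R.
  rewrite /pencil_weight big_split -mulr_sumr; congr (_ + _) => /=.
  by apply: eq_bigr => l _; rewrite card_vspace_exp.
have defK : q * K = D + (q - 1) * R.
  rewrite !mulr_sumr -big_split; apply: eq_bigr => l _ /=.
  exact: card_singular.
have defX : q * #|sing|%:Z = N.
  have := card_singular card_F quad_eta fullv.
  rewrite gauss_sum_nucleus ?memvf // mulr0 addr0 card_vspace_exp dim_V -/N => <-.
  by congr (_ * Posz _); apply: eq_card => x; rewrite !inE memvf.
have def1 : q * S1 = N * #|sing|%:Z + (q - 1) * N.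
  rewrite mulr_sumr; have sing0 : 0 \in sing by rewrite inE (quad0 quad_eta).
  rewrite (bigD1 0) //= (eq_bigr (fun _ => N)) => [|x].
    rewrite card_perpv_line // mem0v sumr_const -mulr_natl natz.
    rewrite (cardD1 0 sing) sing0 PoszD mulrDr.
    have -> : #|[predD1 sing & 0]| = #|(fun i : V => (eta i == 0) && (i != 0))|.
      by apply: eq_card => x; rewrite !inE andbC.
    by rewrite mulr1; ring.
  rewrite card_perpv_line // rad_r => /andP[/eqP eta_x x_neq0]; case: ifP => // /vlineP[a def_x].
  move: eta_x; rewrite def_x (quadZ quad_eta) eta_r mulr1 => /eqP.
  by rewrite expf_eq0 /= => /eqP a0; rewrite def_x a0 scale0r eqxx in x_neq0.
have def2 : q ^+ 2 * S2 = q * N * #|sing|%:Z + (q - 1) * N * K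
    - (#|sing|%:Z - 1) * (q - 1) * N by exact: sum_card_common_perp.
have def3 : q ^+ 2 * S3 = (q - 1) * N * R by exact: sum_gauss_sum_common_perp.
have defP : q * P = S1 - S2 - (q - 1) * S3.
  have -> : P = \sum_(x in sing) #|[pred y | [&& eta y == 0, beta x y == 0 & phi x y != 0]]|%:Z.
    rewrite /P -sum1_card -natz natr_sum.
    transitivity (\sum_(p : V * V | (p.1 \in sing)
      && [&& eta p.2 == 0, beta p.1 p.2 == 0 & phi p.1 p.2 != 0]) (1 : int)).
      by apply: eq_big => [p|p _]; rewrite ?inE ?natz.
    rewrite -(pair_big_dep (fun x => x \in sing)
      (fun x y => [&& eta y == 0, beta x y == 0 & phi x y != 0]) (fun _ _ => 1)) /=.
    by apply: eq_bigr => x _; rewrite sumr_const natz.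
  rewrite mulr_sumr -sumrB mulr_sumr -sumrB; apply: eq_bigr => x _.
  have := card_singular card_F quad_eta (perpv beta <[x]>).
  rewrite (gauss_sum_nucleus (nucleus_in_perp _)) mulr0 addr0 => <-.
  rewrite -addrA -opprD -(card_singular card_F quad_eta) -mulrBr; congr (_ * _).
  apply/eqP; rewrite eq_sym subr_eq -(cardID [pred y | phi x y == 0]) PoszD addrC; apply/eqP.
  congr (Posz _ + Posz _); apply: eq_card => y.
    rewrite !inE memv_perp_line //.
    by case: (eta y == 0) (beta x y == 0) (phi x y == 0) => [] [] [].
  by rewrite !inE memv_cap !memv_perp_line // andbAC.
rewrite defT.
move: (#|sing|%:Z) def1 def2 defX => X def1 def2 defX.
have -> : q ^+ 4 * P = q ^+ 3 * (q * P) by ring.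
rewrite defP; have -> : q ^+ 3 * (S1 - S2 - (q - 1) * S3)
  = q ^+ 2 * (q * S1) - q * (q ^+ 2 * S2) - (q - 1) * q * (q ^+ 2 * S3) by ring.
rewrite def1 def2 def3.
transitivity ((q - 1) * N * (q ^+ 2 - q * K - q + q * X - q * (q - 1) * R)); first ring.
by rewrite defK defX; ring.
Qed.

End CountingSingularPairs.

End Nucleus.

(** * Integer inequalities between values of Theta *)

(** For radicals of dimension at most 1 containing r, where Theta is at most q * q. Here and in the
    following inequalities x is q, T is q^(2n-1) and Q is q^(n-2). *)
Lemma small_pencil_bound (x T : int) :
  2 <= x -> 1 <= T -> x * x <= T + x ^+ 3 + x ^+ 2 - 2 * x.
Proof. nia. Qed.

(** [x ^+ 3 * a] and [x ^+ 3 * b] are the sizes of a large radical and of its perp, which contains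
    all other radicals. At the largest S the slack is x^3 (a-1) (b-1): equality holds when one of
    the two has dimension 3. *)
Lemma two_eigenspaces_bound (x S a b : int) : 2 <= x ->
  S <= x ^+ 3 * b - x -> 1 <= a -> 1 <= b ->
  x ^+ 3 * a + (S + (x - 1) * x) <= x ^+ 3 * a * b + x ^+ 3 + x ^+ 2 - 2 * x.
Proof.
move=> x2 leS a1 b1; have : 0 <= x ^+ 3 * ((a - 1) * (b - 1)).
  by rewrite !mulr_ge0 ?exprn_ge0 //; lia.
nia.
Qed.

(** The radical of codimension 2 has Gauss sum 0; c counts the nonzero singular vectors of the other
    radicals and S is the sum of their Gauss sums. *)
Lemma rank2_bound (x T S c : int) : 2 <= x ->
  (x - 1) * S = x * c -> c <= x - 1 ->
  T + (x - 1) * x + (x ^+ 2 - 1) * (0 + S) <= T + x ^+ 3 + x ^+ 2 - 2 * x.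
Proof.
move=> x2 defS lec; have leS : S <= x by nia.
have : 0 <= (x ^+ 2 - 1) * (x - S) by rewrite mulr_ge0 //; nia.
nia.
Qed.

(** The radical of codimension 2 has Gauss sum -b and all other Gauss sums vanish. *)
Lemma elliptic_bound (x T b : int) : 2 <= x -> 0 <= b ->
  T + (x - 1) * x + (x ^+ 2 - 1) * - b <= T + x ^+ 3 + x ^+ 2 - 2 * x.
Proof.
move=> x2 b0; have : 0 <= (x ^+ 2 - 1) * b by rewrite mulr_ge0 //; nia.
nia.
Qed.

(** The case n = 2 with c singular radicals; both sides agree at c = 2. *)
Lemma plane_bound (x : int) (c : nat) : 2 <= x -> (c <= 2)%N ->
  x * x + (x ^+ 2 - 1) * (c%:Z * x) <= x ^+ 3 + x ^+ 3 + x ^+ 2 - 2 * x.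
Proof.
move=> x2 c2; have : 0 <= (x ^+ 2 - 1) * x * (2 - c%:Z) by rewrite !mulr_ge0 //; nia.
nia.
Qed.

Lemma not_rank2_lt_min (x Q : int) : 2 <= x -> 1 <= Q ->
  x * Q ^+ 2 + (x - 1) * (x ^+ 2 * Q) + (x ^+ 2 - 1) * (x ^+ 2 * Q)
  < x ^+ 3 * Q ^+ 2 + x ^+ 4 * Q - x ^+ 2 * Q + x ^+ 2 - x.
Proof.
move=> x2 Q1; have : 0 <= (x ^+ 2 - 1) * x * (Q * (Q - 1)) by rewrite !mulr_ge0 //; nia.
have : 0 <= (x - 1) * x * Q by rewrite !mulr_ge0 //; lia.
nia.
Qed.

(** The hypothesis x^2 <= Q means n >= 4. For n = 3, that is Q = x, the left side exceeds the right
    one by x (x-2) (x^2-1), which is positive for x > 2. *)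
Lemma not_rank2_le_second (x Q : int) : 2 <= x -> x ^+ 2 <= Q ->
  x * Q ^+ 2 + (x - 1) * (x ^+ 2 * Q) + (x ^+ 2 - 1) * (x ^+ 2 * Q)
  <= x ^+ 3 * Q ^+ 2 + x ^+ 3 + x ^+ 2 - 2 * x.
Proof.
move=> x2 Qx; have Q0 : 0 <= Q by nia.
have : 0 <= (x ^+ 2 - 1) * x * (Q * (Q - x ^+ 2)).
  by rewrite !mulr_ge0 ?subr_ge0 //; nia.
have : 0 <= Q * (x ^+ 2 * (x - 1)) * (x ^+ 2 - 2).
  by rewrite !mulr_ge0 //; nia.
have : 0 <= x ^+ 3 + x ^+ 2 - 2 * x by nia.
have -> : x * Q ^+ 2 + (x - 1) * (x ^+ 2 * Q) + (x ^+ 2 - 1) * (x ^+ 2 * Q)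
  = x ^+ 3 * Q ^+ 2 - (x ^+ 2 - 1) * x * (Q * (Q - x ^+ 2))
    - Q * (x ^+ 2 * (x - 1)) * (x ^+ 2 - 2) by ring.
lia.
Qed.

Lemma second_lt_min (x T b : int) : 2 <= x -> x < b ->
  T + x ^+ 3 + x ^+ 2 - 2 * x < T + x ^+ 2 * b - b + x ^+ 2 - x.
Proof.
move=> x2 lt_xb; have : 0 < (x ^+ 2 - 1) * (b - x) by rewrite mulr_gt0 //; nia.
nia.
Qed.

(** * Extremal pencils *)

Section Pencil.
Variables (F : finFieldType) (V0 : vectType F) (e m : nat).
Local Notation V := (finvect_type V0).
Hypothesis card_F : #|F| = (2 ^ e)%N.
Variable eta : V -> F.
Hypothesis nondeg_eta : nondegenerate_quadratic_form eta.
Hypothesis dim_V : (\dim (fullv : {vspace V}) = m.+2.*2.+1)%N.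
Variable r : V.
Hypothesis eta_r : eta r = 1.
Hypothesis rad_r : radv (polar eta) = <[r]>%VS.
Variable phi : V -> V -> F.
Hypothesis alt_phi : alternating_form phi.
Implicit Types (u w x y z : V) (A B U : {vspace V}).
Local Notation q := (#|F|%:Z).
Local Notation beta := (polar eta).
Local Notation G := (gauss_sum e eta).
Local Notation psi := (pencil phi beta).
Local Notation R l := (radv (psi l)).

Let quad_eta : quadratic_form eta := nondeg_eta.1.
Let alt_beta : alternating_form beta := alternating_polar card_F quad_eta.
Let alt_psi l : alternating_form (psi l) := alternating_pencil l alt_phi alt_beta.
Let q_ge2 : 2 <= q := card_field_ge2 F.
Let beta_r := nucleus_perp card_F nondeg_eta rad_r.
Let q_ge1 : 1 <= q := le_trans (isT : 1 <= 2 :> int) q_ge2.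
Let q_ge0 : 0 <= q := ltW (card_field_gt0 F).

(** So [R l] is the eigenspace of phi relative to beta for the eigenvalue l, and distinct radicals
    are related like distinct eigenspaces. *)
Lemma mem_pencil_radv l x : reflect (forall y, phi x y = l * beta x y) (x \in R l).
Proof.
apply: (iffP (memv_radv _ (alt_psi l))) => xl y; first by apply/eqP; rewrite -subr_eq0; apply/eqP/xl.
by rewrite /pencil xl subrr.
Qed.

Lemma nucleus_pencil_radv l : (r \in R l) = (r \in radv phi).
Proof.
apply/mem_pencil_radv/(memv_radv _ alt_phi) => r0 y; last by rewrite r0 beta_r mulr0.
by rewrite r0 beta_r mulr0.
Qed.

Lemma odd_dim_pencil_radv l : odd (\dim (R l)).
Proof.
have := odd_dim_radical card_F fullv (alt_psi l).
by rewrite capfv dim_V /= odd_double.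
Qed.

(** For z in [R l] and x in [R k], both l and k times beta z x equal phi z x. *)
Lemma pencil_radv_perp l k : l != k -> (R k <= perpv beta (R l))%VS.
Proof.
move=> ne_lk; apply/subvP => x /mem_pencil_radv xk; apply/(memv_perp _ _ alt_beta) => z.
move/mem_pencil_radv => zl; have := altC alt_phi z x.
rewrite xk zl (altC alt_beta z x) mulrN => /eqP; rewrite eqr_opp -subr_eq0 -mulrBl.
by rewrite mulf_eq0 subr_eq0 eq_sym (negbTE ne_lk) => /eqP.
Qed.

Lemma pencil_radv_cap l k x : l != k -> x \in R l -> x \in R k -> x \in <[r]>%VS.
Proof.
move=> ne_lk /mem_pencil_radv xl /mem_pencil_radv xk; rewrite -rad_r.
apply/(memv_radv _ alt_beta) => y; have /eqP := xl y; rewrite xk -subr_eq0 -mulrBl.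
by rewrite mulf_eq0 subr_eq0 eq_sym (negbTE ne_lk) => /eqP.
Qed.

Lemma singular_nucleus x : x \in <[r]>%VS -> eta x = 0 -> x = 0.
Proof.
case/vlineP => a ->; rewrite (quadZ quad_eta) eta_r mulr1 => /eqP.
by rewrite expf_eq0 => /= /eqP->; rewrite scale0r.
Qed.

(** By [sum_gauss_sum_common_perp] the sum is a multiple of the sum of G (W x) over singular x. The
    terms with phi r x = 0 vanish because [W x] contains r; the others are at most q^n, and their
    number, |X| - |Y|, cancels the factor exactly. *)
Lemma sum_gauss_sum_pencil_le : r \notin radv phi -> \sum_l G (R l) <= q ^+ m.+2.
Proof.
move=> nr; have := sum_gauss_sum_common_perp card_F nondeg_eta dim_V eta_r rad_r alt_phi.
set N := q ^+ m.+2.*2.+1 => defS.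
have q_gt0 : 0 < q := card_field_gt0 F; have N_gt0 : 0 < N by rewrite exprn_gt0.
pose X := [pred x : V | eta x == 0]; pose Y := [pred x in perpv phi <[r]>%VS | eta x == 0].
have cardX : q * #|X|%:Z = N.
  have := card_singular card_F quad_eta fullv.
  rewrite (gauss_sum_nucleus card_F nondeg_eta eta_r rad_r (memvf r)) mulr0 addr0.
  rewrite card_vspace_exp dim_V -/N => <-.
  by congr (_ * Posz _); apply: eq_card => x; rewrite !inE memvf.
have cardY : q ^+ 2 * #|Y|%:Z = N.
  have := card_singular card_F quad_eta (perpv phi <[r]>).
  rewrite (gauss_sum_nucleus card_F nondeg_eta eta_r rad_r); last first.
    by rewrite memv_perp_line // altxx.
  rewrite mulr0 addr0 expr2 -mulrA => ->.
  by rewrite (card_perpv_line card_F dim_V r alt_phi) (negbTE nr).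
suff: \sum_(x : V | eta x == 0) G (perpv beta <[x]> :&: perpv phi <[x]>)%VS
    <= (#|X|%:Z - #|Y|%:Z) * q ^+ m.+2.
  move=> leS; have : q ^+ 2 * \sum_(x : V | eta x == 0) G (perpv beta <[x]> :&: perpv phi <[x]>)%VS
      <= q ^+ 2 * ((#|X|%:Z - #|Y|%:Z) * q ^+ m.+2) by rewrite ler_wpM2l // exprn_ge0 // ltW.
  have -> : q ^+ 2 * ((#|X|%:Z - #|Y|%:Z) * q ^+ m.+2)
      = (q * (q * #|X|%:Z) - q ^+ 2 * #|Y|%:Z) * q ^+ m.+2 by ring.
  rewrite defS cardX cardY; have -> : q * N - N = (q - 1) * N by ring.
  by rewrite ler_pM2l // mulr_gt0 //; lia.
rewrite (bigID (mem Y)) /= big1 ?add0r => [|x /andP[eta_x]]; last first.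
  rewrite inE memv_perp_line // => /andP[rx _].
  apply: (gauss_sum_nucleus card_F nondeg_eta eta_r rad_r).
  rewrite memv_cap (nucleus_in_perp card_F nondeg_eta rad_r) memv_perp_line //.
  by rewrite altC_eq0.
apply: (@le_trans _ _ (\sum_(x : V | (eta x == 0) && (x \notin Y)) q ^+ m.+2)).
  apply: ler_sum => x /andP[eta_x nYx]; apply: (gauss_sum_le card_F nondeg_eta dim_V rad_r).
  rewrite memv_cap negb_and (memv_perp_line x r alt_phi) altC_eq0 //; apply/orP; right.
  by move: nYx; rewrite inE memv_perp_line // eta_x andbT.
rewrite sumr_const -mulr_natl natz ler_wpM2r ?exprn_ge0 //.
rewrite -(cardID Y X) PoszD.
have -> : #|[predI X & Y]| = #|Y|.
  by apply: eq_card => x; rewrite !inE; case: (eta x == 0); rewrite ?andbT ?andbF.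
rewrite addrAC subrr add0r lez_nat; apply: subset_leq_card; apply/subsetP => x.
by rewrite !inE andbC.
Qed.

(* The values of Theta that correspond to the two smallest weights, for n = m + 2. *)
Definition min_pencil_weight := q ^+ m.*2.+3 + q ^+ m.+4 - q ^+ m.+2 + q ^+ 2 - q.
Definition second_pencil_weight := q ^+ m.*2.+3 + q ^+ 3 + q ^+ 2 - 2 * q.


(** All Gauss sums vanish, so only sizes count. Once some radical has dimension at least 3, all
    others lie in its perp and meet pairwise inside <r>, so their total size is controlled by that
    of the perp. *)
Lemma pencil_weight_le_of_nucleus : r \in radv phi -> (forall l, R l != fullv) ->
  pencil_weight e eta phi <= second_pencil_weight.
Proof.
move=> rphi nfull; have rR l : r \in R l by rewrite nucleus_pencil_radv.
have -> : pencil_weight e eta phi = \sum_l q ^+ \dim (R l).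
  by apply: eq_bigr => l _; rewrite (gauss_sum_nucleus card_F nondeg_eta eta_r rad_r) // mulr0 addr0.
have [/forallP small | /forallPn[l0]] := boolP [forall l, (\dim (R l) <= 1)%N].
  have leS : \sum_l q ^+ \dim (R l) <= \sum_(l : F) q.
    apply: ler_sum => l _; rewrite -[leRHS]expr1 ler_weXn2l ?small // expr1.
  rewrite sumr_const -mulr_natl natz in leS; apply: le_trans leS _.
  by apply: small_pencil_bound; rewrite ?exprn_ege1.
rewrite -ltnNge => D_gt1; set D := \dim (R l0) in D_gt1.
have D_ge3 : (3 <= D)%N by have := odd_dim_pencil_radv l0; rewrite -/D; lia.
have D_le : (D <= m.*2.+3)%N.
  have : (D < m.+2.*2.+1)%N.
    rewrite -dim_V ltn_neqAle dimvS ?subvf // andbT (dimv_leqif_eq (subvf _)).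
    exact: nfull.
  by have := odd_dim_pencil_radv l0; rewrite -/D doubleS /= => oddD; lia.
pose P := perpv beta (R l0).
have dimP : (\dim P = m.+2.*2.+2 - D)%N.
  have := dim_perp card_F (R l0) alt_beta; rewrite rad_r dim_V.
  have -> : (R l0 :&: <[r]> = <[r]>)%VS by apply/capv_idPr; rewrite -memvE.
  rewrite dim_vline (nucleus_neq0 nondeg_eta eta_r) -/P -/D; lia.
have Pr : r \in P := nucleus_in_perp card_F nondeg_eta rad_r _.
have card_minus A : r \in A -> #|[pred x in A | x \notin <[r]>%VS]|%:Z = q ^+ \dim A - q.
  move=> Ar; apply/eqP; rewrite eq_sym subr_eq -card_vspace_exp.
  have <- : #|<[r]>%VS|%:Z = q.
    by rewrite card_vspace_exp dim_vline (nucleus_neq0 nondeg_eta eta_r) expr1.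
  rewrite -(cardID (mem <[r]>%VS) (mem A)) PoszD addrC; apply/eqP; congr (Posz _ + Posz _).
    by apply: eq_card => x; rewrite !inE andbC.
  apply: eq_card => x; rewrite !inE; apply/andP/idP => [[] // | rx]; split=> //.
  by case/vlineP: rx => a ->; rewrite memvZ.
have disj : \sum_(l | l != l0) (q ^+ \dim (R l) - q) <= q ^+ \dim P - q.
  rewrite -card_minus // (eq_bigr _ (fun l _ => esym (card_minus _ (rR l)))).
  have := @sum_card_disjoint F V (fun l => l != l0)
    (fun l => [pred x in R l | x \notin <[r]>%VS]) [pred x in P | x \notin <[r]>%VS].
  rewrite -lez_nat -natz natr_sum; under eq_bigr do rewrite natz.
  apply=> [l ne_l x | l k x _ _].
    by rewrite !inE => /andP[Rx ->]; rewrite (subvP (pencil_radv_perp _) x Rx) // eq_sym.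
  rewrite !inE => /andP[lx nx] /andP[kx _]; apply/eqP; apply: contraNT nx => ne_lk.
  exact: (pencil_radv_cap ne_lk).
rewrite (bigD1 l0) //= -/D.
have -> : \sum_(l | l != l0) q ^+ \dim (R l)
    = \sum_(l | l != l0) (q ^+ \dim (R l) - q) + (q - 1) * q.
  rewrite sumrB -[LHS]addr0 -addrA; congr (_ + _).
  by rewrite sum_neq_const addNr.
have defP : \dim P = (3 + (m.*2.+3 - D))%N by rewrite dimP doubleS; lia.
rewrite defP in disj; have defD : D = (3 + (D - 3))%N by lia.
have defm : m.*2.+3 = (3 + (D - 3) + (m.*2.+3 - D))%N by lia.
rewrite /second_pencil_weight defm {1}defD; rewrite !exprD in disj *.
have q1 i : 1 <= q ^+ i by rewrite exprn_ege1.
move: disj (q1 (D - 3)%N) (q1 (m.*2.+3 - D)%N).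
rewrite /D; move: (\sum_(l | _) _) => S; move: (q ^+ (_ - 3)) (q ^+ (_ - _)) => a b.
exact: two_eigenspaces_bound.
Qed.

Lemma card_nonzero_singular U (sing := [pred x in U | eta x == 0]) :
  #|sing|%:Z = #|[predD1 sing & 0]|%:Z + 1.
Proof. by rewrite (cardD1 0 sing) inE mem0v (quad0 quad_eta) eqxx addrC. Qed.

Lemma dim_perp_rank2 U : r \notin U -> \dim U = m.*2.+3 -> \dim (perpv beta U) = 2%N.
Proof.
by move=> nUr dimU; have := dim_perp_nucleus card_F nondeg_eta dim_V rad_r nUr; rewrite dimU; lia.
Qed.

(** The dimension is odd like that of U, and less than 2 because the perp of U is a plane containing
    r while U does not. *)
Lemma dim_radical_rank2 U : r \notin U -> \dim U = m.*2.+3 -> \dim (U :&: perpv beta U) = 1%N.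
Proof.
move=> nUr dimU; have dimP := dim_perp_rank2 nUr dimU; set N0 := (U :&: _)%VS.
have : odd (\dim N0) by rewrite (odd_dim_radical card_F) // dimU /= odd_double.
have : (\dim N0 < 2)%N; last by case: (\dim N0) => [|[]].
rewrite -dimP ltn_neqAle dimvS ?capvSr // andbT (dimv_leqif_eq (capvSr _ _)).
apply: contra nUr => /eqP defN0; have: r \in N0 by rewrite /N0 defN0 (nucleus_in_perp card_F nondeg_eta rad_r).
by rewrite memv_cap => /andP[].
Qed.

(** The other radicals lie in the plane [P], which contains r, but avoid r: all have dimension 1.
    Since r is in [P], this plane has only q - 1 nonzero singular vectors to share among the
    radicals. If the radical [N0] of [R l0] is singular, it takes them all and G (R l0) is q^n or
    -q^n; otherwise G (R l0) is 0. *)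
Lemma pencil_weight_rank2 l0 : r \notin radv phi -> \dim (R l0) = m.*2.+3 ->
  if G (R l0) == q ^+ m.+2 then pencil_weight e eta phi = min_pencil_weight
  else pencil_weight e eta phi <= second_pencil_weight.
Proof.
move=> nr dimR0; have nR l : r \notin R l by rewrite nucleus_pencil_radv.
pose P := perpv beta (R l0); have Pr : r \in P := nucleus_in_perp card_F nondeg_eta rad_r _.
have dimP : \dim P = 2%N := dim_perp_rank2 (nR l0) dimR0.
have dim_sub A : (A <= P)%VS -> r \notin A -> (\dim A <= 1)%N.
  move=> sAP nAr; suff: (\dim A < \dim P)%N by rewrite dimP.
  rewrite ltn_neqAle dimvS // andbT (dimv_leqif_eq sAP).
  by apply: contra nAr => /eqP->.
have RP l : l != l0 -> (R l <= P)%VS by move=> ne_l; apply: pencil_radv_perp; rewrite eq_sym.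
have dimR l : l != l0 -> \dim (R l) = 1%N.
  by move=> ne_l; have := odd_dim_pencil_radv l; have := dim_sub _ (RP l ne_l) (nR l); case: (\dim _) => [|[]].
pose N0 := (R l0 :&: P)%VS.
have dimN0 : \dim N0 = 1%N := dim_radical_rank2 (nR l0) dimR0.
pose A l := [pred x in (R l :&: P)%VS | (x != 0) && (eta x == 0)].
have leA : \sum_l #|A l|%:Z <= q - 1.
  have cardP := card_singular card_F quad_eta P.
  rewrite (gauss_sum_nucleus card_F nondeg_eta eta_r rad_r Pr) mulr0 addr0 in cardP.
  rewrite card_vspace_exp dimP expr2 card_nonzero_singular in cardP.
  have {cardP} cardP := mulfI (lt0r_neq0 (card_field_gt0 F)) cardP.
  rewrite -cardP addrK.
  have := @sum_card_disjoint F V predT A [predD1 [pred x in P | eta x == 0] & 0].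
  rewrite -lez_nat -natz natr_sum; under eq_bigr do rewrite natz.
  apply=> [l _ x | l k x _ _].
    by rewrite !inE memv_cap => /andP[/andP[_ ->] /andP[-> ->]].
  rewrite !inE !memv_cap => /andP[/andP[lx _] /andP[x_neq0 /eqP eta_x]] /andP[/andP[kx _] _].
  apply/eqP; apply: contraNT x_neq0 => ne_lk; apply/eqP.
  have xr := pencil_radv_cap ne_lk lx kx.
  exact: (singular_nucleus xr eta_x).
have defG l : l != l0 -> (q - 1) * G (R l) = q * #|A l|%:Z.
  move=> ne_l; have := card_singular card_F quad_eta (R l).
  rewrite card_nonzero_singular card_vspace_exp dimR // expr1.
  have -> : #|[predD1 [pred x in R l | eta x == 0] & 0]| = #|A l|.
    apply: eq_card => x; rewrite !inE memv_cap; case Rx: (x \in R l); rewrite ?andbF //=.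
    by rewrite (subvP (RP l ne_l)).
  lia.
pose S := \sum_(l | l != l0) G (R l).
have defS : (q - 1) * S = q * \sum_(l | l != l0) #|A l|%:Z.
  by rewrite !mulr_sumr; apply: eq_bigr => l /defG.
have A_ge0 : 0 <= \sum_(l | l != l0) #|A l|%:Z by apply: sumr_ge0.
rewrite (bigD1 l0) //= in leA.
have -> : pencil_weight e eta phi = q ^+ m.*2.+3 + (q - 1) * q + (q ^+ 2 - 1) * (G (R l0) + S).
  rewrite /pencil_weight big_split -mulr_sumr (bigD1 l0) //= dimR0; congr (_ + _ + _ * _).
    by rewrite -(sum_neq_const l0); apply: eq_bigr => l /dimR->.
  by rewrite (bigD1 l0).
have [/exists_inP[h] | /exists_inPn sing] := boolP [exists h in N0, eta h != 0].
  rewrite memv_cap => /andP[Rh Ph] eta_h.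
  rewrite (gauss_sum_eq0 card_F quad_eta Rh Ph eta_h) eq_sym expf_eq0 /=.
  rewrite (gt_eqF (card_field_gt0 F)); apply: (rank2_bound _ q_ge2 defS).
  by apply: le_trans leA; rewrite lerDr.
have sing0 h : h \in N0 -> eta h = 0 by move/sing; rewrite negbK => /eqP.
have cardA0 : #|A l0|%:Z = q - 1.
  apply: (addIr 1); rewrite subrK.
  have -> : #|A l0| = #|[predD1 [pred x in N0 | eta x == 0] & 0]|.
    by apply: eq_card => x; rewrite !inE; case: (x \in N0); rewrite ?andbF.
  rewrite -card_nonzero_singular -[RHS]expr1 -dimN0 -card_vspace_exp; congr Posz.
  by apply: eq_card => x; rewrite inE; case Nx: (x \in N0); rewrite //= sing0 ?eqxx.
(* The nonzero vectors of [N0] exhaust the nonzero singular vectors of [P]. *)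
have A0 : \sum_(l | l != l0) #|A l|%:Z = 0.
  by apply/le_anti; rewrite A_ge0 andbT; move: leA; rewrite cardA0 gerDl.
have S0 : S = 0.
  by move/eqP: defS; rewrite A0 mulr0 mulf_eq0 => /orP[|/eqP//]; rewrite subr_eq0 gt_eqF // (lt_le_trans _ q_ge2).
have G2 : G (R l0) ^+ 2 = (q ^+ m.+2) ^+ 2.
  rewrite (gauss_sum_sqr_singular card_F) // => [|h Rh Ph]; last by rewrite sing0 // memv_cap Rh.
  by rewrite -/P -/N0 dimR0 dimN0 -exprM; congr (_ ^+ _); lia.
rewrite S0 addr0; case: eqP => [-> | neG]; first by rewrite /min_pencil_weight (exprD q 2 m.+2); ring.
have := eqf_sqr (G (R l0)) (q ^+ m.+2); rewrite G2 eqxx => /esym/orP[/eqP // | /eqP ->].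
have : 0 <= q ^+ m.+2 by rewrite exprn_ge0.
by rewrite /second_pencil_weight; exact: elliptic_bound.
Qed.

(** * Pencils without a radical of codimension 2 *)

Section NotRankTwo.
Hypothesis nr : r \notin radv phi.
Hypothesis not_rank2 : forall l, \dim (R l) != m.*2.+3.

Let nR l : r \notin R l. Proof. by rewrite nucleus_pencil_radv. Qed.

Let dim_perp_R l : (\dim (R l) + \dim (perpv beta (R l)) = m.*2 + 5)%N.
Proof. by rewrite (dim_perp_nucleus card_F nondeg_eta dim_V rad_r (nR l)); lia. Qed.

Let dim_R_le l : (\dim (R l) <= m.*2.+1)%N.
Proof.
have : (0 < \dim (perpv beta (R l)))%N.
  rewrite lt0n dimv_eq0; apply: contra (nucleus_neq0 nondeg_eta eta_r) => /eqP P0.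
  by rewrite -memv0 -P0 (nucleus_in_perp card_F nondeg_eta rad_r).
have := odd_dim_pencil_radv l; have := dim_perp_R l; have := not_rank2 l.
by move: (\dim _) (\dim _) => a b; lia.
Qed.

Let dim_RD l k : l != k -> (\dim (R l) + \dim (R k) <= m.*2 + 5)%N.
Proof. by move=> ne_lk; rewrite -(dim_perp_R l) leq_add2l dimvS ?pencil_radv_perp. Qed.

Lemma pencil_weight_le_not_rank2 : (0 < m)%N ->
  pencil_weight e eta phi
    <= q ^+ m.*2.+1 + (q - 1) * q ^+ m.+2 + (q ^+ 2 - 1) * q ^+ m.+2.
Proof.
move=> m_gt0; rewrite /pencil_weight big_split -mulr_sumr; apply: lerD.
  (* Two radicals of dimension at least m + 3 would exceed the total 2m + 5 allowed to orthogonal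
     radicals. *)
  have [l0 small] : exists l0, forall k, k != l0 -> (\dim (R k) <= m.+2)%N.
    have [/existsP[l0 big] | /existsPn small] := boolP [exists l0, (m.+2 < \dim (R l0))%N].
      by exists l0 => k ne_k; have := dim_RD ne_k; lia.
    by exists 0 => k _; rewrite leqNgt small.
  rewrite (bigD1 l0) //= -(sum_neq_const l0); apply: lerD.
    by rewrite ler_weXn2l.
  by apply: ler_sum => l ne_l; rewrite ler_weXn2l ?small.
rewrite ler_wpM2l //; first by rewrite subr_ge0 exprn_ege1.
exact: (sum_gauss_sum_pencil_le nr).
Qed.

Lemma pencil_weight_plane : m = 0%N -> pencil_weight e eta phi <= second_pencil_weight.
Proof.
move=> m0.
have dimR l : \dim (R l) = 1%N.
  by have := odd_dim_pencil_radv l; have := dim_R_le l; rewrite m0; case: (\dim _) => [|[]].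
have gen l : exists2 w, w != 0 & R l = <[w]>%VS.
  have Rl0 : R l != 0%VS by rewrite -dimv_eq0 dimR.
  exists (vpick (R l)); first by rewrite vpick0.
  apply/eqP; rewrite eq_sym eqEdim dimR dim_vline vpick0 Rl0 andbT.
  by rewrite -memvE memv_pick.
have GR l : G (R l) = if [forall x in R l, eta x == 0] then q else 0.
  case: ifPn => [/forall_inP sing | /forall_inPn[h Rh eta_h]].
    rewrite (gauss_sum_singular e) => [|h /sing/eqP //].
    by rewrite card_vspace_exp dimR expr1.
  apply: (gauss_sum_eq0 card_F quad_eta Rh _ eta_h).
  have [w w0 defR] := gen l; rewrite defR in Rh *.
  case/vlineP: Rh => a ->; rewrite memvZ // memv_perp_line //.
  exact/eqP/(altxx alt_beta).
pose Z := [pred l | [forall x in R l, eta x == 0]].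
(* Three singular radicals would span a totally singular space of dimension 3,
   or be linearly dependent, which distinct eigenvalues l forbid. *)
suff leZ : (#|Z| <= 2)%N.
  rewrite /pencil_weight (eq_bigr (fun l => q + (q ^+ 2 - 1) * (if l \in Z then q else 0))); last first.
    by move=> l _; rewrite dimR expr1 GR.
  rewrite big_split sumr_const -mulr_natl natz -mulr_sumr -big_mkcond sumr_const -mulr_natl natz /=.
  rewrite /second_pencil_weight m0; apply: plane_bound => //.
rewrite leqNgt; apply/negP => /card_gt2P[l [k [j [[Zl Zk Zj] [ne_lk ne_kj ne_jl]]]]].
have [[x x0 Rl] [y y0 Rk] [z z0 Rj]] := And3 (gen l) (gen k) (gen j).
have [xl yk zj] : [/\ x \in R l, y \in R k & z \in R j] by rewrite Rl Rk Rj !memv_line.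
have sing i u : i \in Z -> u \in R i -> eta u = 0.
  by rewrite inE => /forall_inP Zi /Zi/eqP.
have perp i i' u u' : i != i' -> u \in R i -> u' \in R i' -> beta u u' = 0.
  move=> ne_i Ru Ru'; have /(memv_perp _ _ alt_beta) perp_u' := subvP (pencil_radv_perp ne_i) u' Ru'.
  exact: perp_u'.
have [eta_x eta_y eta_z] : [/\ eta x = 0, eta y = 0 & eta z = 0].
  by split; [apply: (sing l) | apply: (sing k) | apply: (sing j)].
have xy := perp _ _ _ _ ne_lk xl yk; have yz := perp _ _ _ _ ne_kj yk zj.
have zx := perp _ _ _ _ ne_jl zj xl.
have nxy i i' u u' a : i != i' -> u \in R i -> eta u = 0 -> u != 0 -> u' \in R i' -> u != a *: u'.
  move=> ne_i Ru eta_u u0 Ru'; apply: contra u0 => /eqP def_u; apply/eqP.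
  apply: (singular_nucleus _ eta_u); apply: (pencil_radv_cap ne_i Ru).
  by rewrite def_u memvZ.
have eta_xy a b : eta (a *: x + b *: y) = 0.
  by rewrite (quadD eta) !(quadZ quad_eta) (altZl alt_beta) (altZr alt_beta) eta_x eta_y xy !mulr0 !addr0.
have [z_xy | nz] := boolP (z \in <[x]> + <[y]>)%VS.
  have [_ /vlineP[a ->] [_ /vlineP[b ->] def_z]] := memv_addP z_xy.
  (* Comparing phi z = j beta z with phi x = l beta x and phi y = k beta y puts this combination in
     the radical of beta; being singular, it vanishes. *)
  have w0 : (a * (l - j)) *: x + (b * (k - j)) *: y = 0.
    apply: (singular_nucleus) => //; rewrite -rad_r.
    apply/(memv_radv _ alt_beta) => v; have := mem_pencil_radv _ _ zj v.
    rewrite def_z (altDl alt_phi) !(altZl alt_phi) (mem_pencil_radv _ _ xl) (mem_pencil_radv _ _ yk).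
    rewrite !(altDl alt_beta) !(altZl alt_beta) => /eqP; rewrite -subr_eq0 => /eqP <-.
    ring.
  have a0 : a = 0.
    have [] := eqVneq (a * (l - j)) 0.
      by move/eqP; rewrite mulf_eq0 subr_eq0 [l == j]eq_sym (negbTE ne_jl) orbF => /eqP.
    move=> al0; have := nxy l k x y (- (b * (k - j)) / (a * (l - j))) ne_lk xl eta_x x0 yk.
    case/eqP; apply: (scalerI al0); rewrite scalerA mulrCA divff // mulr1.
    by apply/eqP; rewrite scaleNr -addr_eq0 w0.
  have : b *: ((k - j) *: y) = 0 by rewrite scalerA -w0 a0 mul0r scale0r add0r.
  move/eqP; rewrite !scaler_eq0 (negbTE y0) subr_eq0 (negbTE ne_kj) !orbF => /eqP b0.
  by rewrite def_z a0 b0 !scale0r addr0 eqxx in z0.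
pose T := (<[z]> + (<[x]> + <[y]>))%VS.
have dimT : \dim T = 3.
  rewrite !dim_add_line // ?dim_vline ?y0 //.
  by apply/vlineP => -[a def_x]; have := nxy l k x y a ne_lk xl eta_x x0 yk; rewrite def_x eqxx.
have singT h : h \in T -> eta h = 0.
  case/memv_addP => _ /vlineP[c ->] [_ /memv_addP[_ /vlineP[a ->] [_ /vlineP[b ->] ->]] ->].
  rewrite (quadD eta) eta_xy (quadZ quad_eta) eta_z mulr0 !add0r.
  rewrite (altZl alt_beta) (altDr alt_beta) !(altZr alt_beta) zx (altC alt_beta y z) yz.
  by rewrite oppr0 !mulr0 addr0 mulr0.
have nrT : r \notin T by apply/negP => /singT; rewrite eta_r => /eqP; rewrite oner_eq0.
(* The Gauss sum of the totally singular [T] is q^3, above the bound q^2 for n = 2. *)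
have := gauss_sum_le card_F nondeg_eta dim_V rad_r nrT.
rewrite (gauss_sum_singular e singT) card_vspace_exp dimT m0 ler_eXn2l ?(lt_le_trans _ q_ge2) //.
Qed.

End NotRankTwo.

Lemma weight_second_lt_min : second_pencil_weight < min_pencil_weight.
Proof.
rewrite /second_pencil_weight /min_pencil_weight (exprD q 2 m.+2).
have : q < q ^+ m.+2 by rewrite -[ltLHS]expr1 ltr_eXn2l // (lt_le_trans _ q_ge2).
exact: second_lt_min.
Qed.

(** The condition on m enters only when r is outside the radical and no radical has codimension 2: m
    = 0 is settled geometrically, m >= 2 by the numerical bound. *)
Lemma pencil_weight_dichotomy : (forall l, R l != fullv) ->
  (exists l0, [/\ r \notin R l0, \dim (R l0) = m.*2.+3 & G (R l0) = q ^+ m.+2])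
    /\ pencil_weight e eta phi = min_pencil_weight
  \/ pencil_weight e eta phi < min_pencil_weight
    /\ (m <> 1%N -> pencil_weight e eta phi <= second_pencil_weight).
Proof.
move=> nfull; have lt_min := weight_second_lt_min.
have [rphi | nr] := boolP (r \in radv phi).
  have le_second := pencil_weight_le_of_nucleus rphi nfull.
  by right; split=> //; apply: le_lt_trans lt_min.
have [/existsP[l0 /eqP dimR0] | /existsPn not_rank2] := boolP [exists l0, \dim (R l0) == m.*2.+3].
  have := pencil_weight_rank2 nr dimR0.
  case: eqP => [GR0 -> | _ le_second].
    left; split=> //; exists l0; split=> //.
    by rewrite (nucleus_pencil_radv).
  by right; split=> //; apply: le_lt_trans lt_min.
right; case: (posnP m) => [m0 | m_gt0].
  have le_second := pencil_weight_plane nr not_rank2 m0.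
  by split=> //; apply: le_lt_trans lt_min.
have le_pw := pencil_weight_le_not_rank2 nr not_rank2 m_gt0.
have expE : (q ^+ m.*2.+1 = q * (q ^+ m) ^+ 2) /\ (q ^+ m.*2.+3 = q ^+ 3 * (q ^+ m) ^+ 2).
  by rewrite -exprM muln2 -exprS -exprD.
rewrite expE.1 (exprD q 2 m) in le_pw.
split=> [|m_neq1].
  apply: le_lt_trans le_pw _; rewrite /min_pencil_weight expE.2 (exprD q 4 m) (exprD q 2 m).
  by apply: not_rank2_lt_min; rewrite ?exprn_ege1.
apply: le_trans le_pw _; rewrite /second_pencil_weight expE.2.
by apply: not_rank2_le_second => //; rewrite ler_weXn2l //; lia.
Qed.

(** * From singular pairs to Hamming weights *)

Section LineCode.
Variables (M : nat) (omega : 'I_M -> V * V).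
Hypothesis omega_lines : line_representatives (V := V) eta omega.
Local Notation line i := (line_of (V := V) (omega i)).
Local Notation w := (hamming_weight (codeword (V := V) omega phi)).

Lemma singular_line_polar A x y : (forall z, z \in A -> eta z = 0) ->
  x \in A -> y \in A -> beta x y = 0.
Proof. by move=> sing Ax Ay; rewrite /polar !sing ?rpredD // !subrr. Qed.

(** On the line, phi is phi p.1 p.2 times the determinant of coordinates, so the pairs counted are
    either none or all the ordered bases of the line. *)
Lemma card_line_pairs (p : V * V) : \dim (line_of (V := V) p) = 2%N ->
  #|[pred xy : V * V | [&& xy.1 \in line_of (V := V) p, xy.2 \in line_of (V := V) p
                         & phi xy.1 xy.2 != 0]]|%:Z
  = (phi p.1 p.2 != 0)%:Z * ((q ^+ 2 - 1) * (q ^+ 2 - q)).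
Proof.
case: p => v1 v2 /=; set L := line_of _ => dimL.
have Lv1 : v1 \in L by rewrite memvE addvSl.
have Lv2 : v2 \in L by rewrite memvE addvSr.
have memL z : z \in L -> exists a b, z = a *: v1 + b *: v2.
  by case/memv_addP => _ /vlineP[a ->] [_ /vlineP[b ->] ->]; exists a, b.
have phiE a b c d : phi (a *: v1 + b *: v2) (c *: v1 + d *: v2) = (a * d - b * c) * phi v1 v2.
  rewrite (altDl alt_phi) !(altDr alt_phi) !(altZl alt_phi) !(altZr alt_phi) !(altxx alt_phi).
  by rewrite (altC alt_phi v1 v2); ring.
have [phi0 | phi_neq0] := eqVneq (phi v1 v2) 0.
  rewrite mul0r (eq_card0 _) // => -[x y]; rewrite !inE /=.
  apply/negP => /and3P[/memL[a [b ->]] /memL[c [d ->]]].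
  by rewrite phiE phi0 mulr0 eqxx.
rewrite mul1r -sum1_card -natz natr_sum.
transitivity (\sum_(x in L) \sum_(y | (y \in L) && (phi x y != 0)) (1 : int)).
  by rewrite pair_big_dep /=; apply: eq_big => [xy|xy _]; rewrite ?inE ?natz.
rewrite (bigD1 0) ?mem0v //= big1 ?add0r => [|y]; last by rewrite alt0l // eqxx andbF.
rewrite (eq_bigr (fun _ => q ^+ 2 - q)) => [|x /andP[Lx x0]].
  rewrite sumr_const -mulr_natl natz; congr (_ * _).
  rewrite -dimL -card_vspace_exp (cardD1 0 L) mem0v PoszD addrAC subrr add0r.
  by congr Posz; apply: eq_card => x; rewrite !inE andbC.
have [u Lu xu] : exists2 u, u \in L & phi x u != 0.
  have [a [b def_x]] := memL x Lx.
  have [a0 | a_neq0] := eqVneq a 0; last first.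
    by exists v2 => //; have := phiE a b 0 1; rewrite scale0r scale1r add0r -def_x => ->;
      rewrite mulr0 subr0 mulr1 mulf_neq0.
  exists v1 => //; have := phiE a b 1 0; rewrite scale0r scale1r addr0 -def_x => ->.
  rewrite mulr0 mulr1 sub0r mulf_neq0 // oppr_eq0; apply: contra x0 => /eqP b0.
  by rewrite def_x a0 b0 !scale0r addr0.
have cardk := card_kernel card_F (alt_phi.1.2 x) Lu xu.
rewrite card_vspace_exp dimL expr2 in cardk.
have {cardk} cardk := mulfI (lt0r_neq0 (card_field_gt0 F)) cardk.
rewrite sumr_const natz -dimL -card_vspace_exp -cardk.
rewrite -(cardID [pred y | phi x y == 0] L) PoszD addrAC.
have -> : #|[predI L & [pred y | phi x y == 0]]| = #|[pred y in L | phi x y == 0]|.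
  by apply: eq_card => y; rewrite !inE.
rewrite subrr add0r; congr Posz; apply: eq_card => y; rewrite !inE andbC //.
Qed.

(** Two orthogonal singular vectors with phi x y <> 0 are independent and span exactly one of the
    singular lines. *)
Lemma card_singular_pairs_hamming :
  #|[pred p : V * V | [&& eta p.1 == 0, eta p.2 == 0,
                      beta p.1 p.2 == 0 & phi p.1 p.2 != 0]]|%:Z
  = (q ^+ 2 - 1) * (q ^+ 2 - q) * w%:Z.
Proof.
have [sing_omega omega_inj omega_onto] := omega_lines.
pose A i := [pred xy : V * V | [&& xy.1 \in line i, xy.2 \in line i & phi xy.1 xy.2 != 0]].
transitivity (\sum_i #|A i|%:Z); last first.
  rewrite /hamming_weight /hamming_distance -sum1_card -[X in _ * X]natz natr_sum mulr_sumr.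
  rewrite [RHS]big_mkcond /=; apply: eq_bigr => i _.
  rewrite card_line_pairs ?(sing_omega i).1 // inE !mxE.
  by case: (phi _ _ != 0); rewrite ?mul1r ?mulr1 ?mul0r.
under eq_bigr do rewrite -sum1_card -natz natr_sum.
rewrite (exchange_big_dep predT) //= -sum1_card -natz natr_sum big_mkcond.
apply: eq_bigr => -[x y] _ /=; rewrite inE /=.
case: ifPn => [/and4P[/eqP eta_x /eqP eta_y /eqP xy0 phi_xy] | not_good].
  have line_xy : singular_line (V := V) eta (line_of (V := V) (x, y)).
    split=> [|z]; last first.
      case/memv_addP => _ /vlineP[a ->] [_ /vlineP[b ->] ->].
      by rewrite (quadD eta) !(quadZ quad_eta) (altZl alt_beta) (altZr alt_beta)
        eta_x eta_y xy0 !mulr0 !addr0.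
    rewrite /line_of /= dim_add_line ?dim_vline.
      by case: (eqVneq y 0) phi_xy => // ->; rewrite alt0r ?eqxx.
    by apply: contra phi_xy => /vlineP[a ->]; rewrite altZl // altxx // mulr0.
  have [i line_i] := omega_onto _ line_xy.
  rewrite (big_pred1 i) ?natz // => j; rewrite inE /=; apply/and3P/eqP => [[jx jy _] | ->].
    apply: omega_inj; rewrite line_i; apply/eqP; rewrite eq_sym eqEdim.
    by rewrite (sing_omega j).1 line_xy.1 leqnn andbT subv_add -!memvE jx jy.
  by rewrite line_i !memvE addvSl addvSr.
rewrite big1 // => i; rewrite inE /= => /and3P[ix iy phi_xy]; case/negP: not_good.
have sing := (sing_omega i).2; rewrite !sing // eqxx phi_xy andbT /=.
by rewrite (singular_line_polar sing ix iy).
Qed.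

Lemma hamming_weight_eq :
  (q ^+ 2 - 1) * w%:Z
  = (q ^+ m) ^+ 2 * (q ^+ 2 + q ^+ 5 * (q ^+ m) ^+ 2 - q - pencil_weight e eta phi).
Proof.
have := card_singular_pairs card_F nondeg_eta dim_V eta_r rad_r alt_phi.
rewrite card_singular_pairs_hamming.
have -> : q ^+ m.+2.*2.+1 = q ^+ 5 * (q ^+ m) ^+ 2.
  by rewrite -exprM -exprD; congr (_ ^+ _); lia.
have q0 : q != 0 := lt0r_neq0 (card_field_gt0 F).
have q1 : q - 1 != 0 by rewrite subr_eq0 gt_eqF // (lt_le_trans _ q_ge2).
have q5 : q ^+ 5 * (q - 1) != 0 by rewrite mulf_neq0 ?expf_neq0.
move=> eq_w; apply: (mulfI q5); apply: etrans (etrans eq_w _); ring.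
Qed.

(** With m = n - 2 the exponents are 4n - 5 and 3n - 4. Both outer factors are positive, so the
    weight exceeds this value exactly when Theta is below its maximum. *)
Lemma hamming_weight_min :
  (q ^+ 2 - 1) * (w%:Z - (q ^+ (4 * m + 3) - q ^+ (3 * m + 2)))
  = (q ^+ m) ^+ 2 * (min_pencil_weight - pencil_weight e eta phi).
Proof.
rewrite mulrBr hamming_weight_eq /min_pencil_weight.
have -> : q ^+ (4 * m + 3) = q ^+ 3 * (q ^+ m) ^+ 4 by rewrite -exprM -exprD; congr (_ ^+ _); lia.
have -> : q ^+ (3 * m + 2) = q ^+ 2 * (q ^+ m) ^+ 3 by rewrite -exprM -exprD; congr (_ ^+ _); lia.
have -> : q ^+ m.*2.+3 = q ^+ 3 * (q ^+ m) ^+ 2 by rewrite -exprM -exprD; congr (_ ^+ _); lia.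
by rewrite (exprD q 4 m) (exprD q 2 m); ring.
Qed.

Lemma hamming_weight_second :
  (q ^+ 2 - 1) * (w%:Z - (q ^+ (4 * m + 3) - q ^+ (2 * m + 1)))
  = (q ^+ m) ^+ 2 * (second_pencil_weight - pencil_weight e eta phi).
Proof.
rewrite mulrBr hamming_weight_eq /second_pencil_weight.
have -> : q ^+ (4 * m + 3) = q ^+ 3 * (q ^+ m) ^+ 4 by rewrite -exprM -exprD; congr (_ ^+ _); lia.
have -> : q ^+ (2 * m + 1) = q * (q ^+ m) ^+ 2 by rewrite -exprM -exprS; congr (_ ^+ _); lia.
have -> : q ^+ m.*2.+3 = q ^+ 3 * (q ^+ m) ^+ 2 by rewrite -exprM -exprD; congr (_ ^+ _); lia.
ring.
Qed.

End LineCode.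

(** The beta-radical of U = R l0 is spanned by a vector p, singular because G U <> 0. A hyperbolic
    partner u of p lies outside U, and J = U :&: perp u is a non-degenerate complement of p in U
    with positive Gauss sum, hence has a hyperbolic basis. Together with r, u and p this gives a
    basis of V, and psi l0, which kills U, sees only the coordinates along r and u. *)
Lemma normal_form l0 : r \notin R l0 -> \dim (R l0) = m.*2.+3 -> 0 < G (R l0) ->
  exists (s : seq V) (k : F), [/\ size s = (m.*2 + 5)%N, (<<s>> = fullv)%VS, k != 0,
    forall c : nat -> F, eta (\sum_(i < m.*2 + 5) c i *: s`_i)
      = c 0%N ^+ 2 + c 1%N * c 2%N + \sum_(j < m.+1) c j.*2.+3 * c j.*2.+4
    & forall c d : nat -> F,
      psi l0 (\sum_(i < m.*2 + 5) c i *: s`_i) (\sum_(i < m.*2 + 5) d i *: s`_i)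
      = k * (c 0%N * d 1%N - c 1%N * d 0%N)].
Proof.
set U := R l0 => nUr dimU GU.
have alt_l := alt_psi l0.
have dimN0 := dim_radical_rank2 nUr dimU.
set N0 := (U :&: _)%VS in dimN0.
pose p := vpick N0; have N0p : p \in N0 := memv_pick _.
have p0 : p != 0 by rewrite vpick0 -dimv_eq0 dimN0.
have defN0 : N0 = <[p]>%VS.
  by apply/eqP; rewrite eq_sym eqEdim -memvE N0p dimN0 dim_vline p0.
have /andP[Up Pp] : (p \in U) && (p \in perpv beta U) by rewrite -memv_cap.
have eta_p : eta p = 0.
  apply/eqP; apply: contraLR GU => eta_p.
  by rewrite (gauss_sum_eq0 card_F quad_eta Up Pp eta_p) ltxx.
have nrad_p : p \notin perpv beta fullv.
  rewrite -[perpv _ _]/(radv _) rad_r; apply: contra p0 => rp.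
  by apply/eqP/(singular_nucleus rp).
have [u [_ eta_u pu]] := hyperbolic_partner card_F quad_eta (memvf p) nrad_p eta_p.
have up : beta u p = 1.
  by rewrite (altC alt_beta p u) pu (oppr_pchar2 (pchar2_of_card card_F)).
have up_neq0 : beta u p != 0 by rewrite up oner_eq0.
pose J := (U :&: perpv beta <[u]>)%VS.
have perp_p x : x \in U -> beta p x = 0.
  move=> Ux; have /(memv_perp _ _ alt_beta) p_perp := Pp.
  by rewrite (altC alt_beta x p) p_perp // oppr0.
have nJp : p \notin J by rewrite memv_cap (memv_perp_line u p alt_beta) (negbTE up_neq0) andbF.
have dimJ : \dim J = m.+1.*2.
  by have := dim_cap_perp_line card_F alt_beta Up up_neq0; rewrite dimU => -[].
have defU : (<[p]> + J)%VS = U.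
  apply/eqP; rewrite eqEdim subv_add -memvE Up capvSl dim_add_line // dimJ dimU.
  by rewrite doubleS /=.
have perp_u x : x \in J -> beta u x = 0.
  by rewrite memv_cap (memv_perp_line u x alt_beta) => /andP[_ /eqP].
have J0 : (J :&: perpv beta J = 0)%VS.
  apply/eqP; rewrite -subv0; apply/subvP => x; rewrite memv_cap => /andP[Jx PJx].
  have Ux : x \in U by move: Jx; rewrite memv_cap => /andP[].
  have : x \in N0.
    rewrite memv_cap Ux -defU perpD // memv_cap PJx andbT memv_perp_line //.
    exact/eqP/perp_p.
  rewrite defN0 => /vlineP[t def_x]; have := perp_u x Jx.
  by rewrite def_x (altZr alt_beta) up mulr1 => ->; rewrite scale0r mem0v.
have GJ : 0 < G J.
  move: GU; rewrite -defU (gauss_sumD card_F quad_eta).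
  - by rewrite (gauss_sum_line e quad_eta eta_p p0) pmulr_rgt0 ?card_field_gt0.
  - apply/subvP => _ /vlineP[t ->]; rewrite memvZ //.
    by apply: (subvP (perpS alt_beta (capvSl _ _))).
  apply/eqP; rewrite -subv0; apply/subvP => x; rewrite memv_cap memv0 => /andP[/vlineP[t ->]].
  by rewrite rpredZeq (negbTE nJp) orbF => /eqP->; rewrite scale0r.
have [s [size_s span_s eta_s]] := hyperbolic_basis card_F quad_eta dimJ J0 GJ.
pose S := [:: r, u, p & s].
have size_S : size S = (m.*2 + 5)%N by rewrite /= size_s doubleS !addnS addn0.
have span_S : (<<S>> = fullv)%VS.
  rewrite !span_cons span_s defU; apply/eqP; rewrite eqEdim subvf /= dim_V.
  have nUu : u \notin U by apply/negP => /perp_p; rewrite pu => /eqP; rewrite oner_eq0.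
  rewrite !dim_add_line // ?dimU ?doubleS //; apply: contra nUr.
  case/memv_addP => _ /vlineP[t ->] [x Ux def_r].
  have := beta_r p; rewrite def_r (altDl alt_beta) (altZl alt_beta) up mulr1.
  rewrite (altC alt_beta p x) perp_p // oppr0 addr0 => t0.
  by rewrite t0 scale0r add0r.
have expand (c : nat -> F) : exists z, [/\ z \in J,
    eta z = \sum_(j < m.+1) c j.*2.+3 * c j.*2.+4
    & \sum_(i < m.*2 + 5) c i *: S`_i = c 0%N *: r + (c 1%N *: u + (c 2%N *: p + z))].
  exists (\sum_(i < m.+1.*2) c i.+3 *: s`_i); split.
  - apply: rpred_sum => i _; rewrite memvZ // -span_s memv_span //.
    by rewrite mem_nth // size_s ltn_ord.
  - exact: (eta_s (fun i => c i.+3)).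
  by rewrite -size_S /= size_s !big_ord_recl.
exists S, (psi l0 r u); split=> // [|c|c d].
(* The constant k is psi l0 r u; were it 0, r would lie in the radical U. *)
- apply: contra nUr => /eqP psi_ru; apply/(memv_radv _ alt_l) => y.
  have : y \in <<S>>%VS by rewrite span_S memvf.
  rewrite !span_cons span_s defU => /memv_addP[_ /vlineP[a ->] [_ /memv_addP[_ /vlineP[b ->] [x Ux ->]] ->]].
  rewrite !(altDr alt_l) !(altZr alt_l) (altxx alt_l) psi_ru !mulr0 !add0r.
  by rewrite (altC alt_l x r) (memv_radv _ alt_l Ux) oppr0.
- have [z [Jz <- ->]] := expand c.
  have Uz : z \in U by rewrite -defU (subvP (addvSr _ _)).
  rewrite (quadD eta) (altZl alt_beta) beta_r mulr0 addr0 (quadZ quad_eta) eta_r mulr1.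
  rewrite -addrA; congr (_ + _).
  rewrite (quadD eta (c 1%N *: u)) (quadZ quad_eta) eta_u mulr0 add0r.
  rewrite (quadD eta (c 2%N *: p)) (quadZ quad_eta) eta_p mulr0 add0r.
  rewrite !(altZl alt_beta) perp_p // mulr0 addr0 (altDr alt_beta) (altZr alt_beta) up perp_u //.
  by rewrite addr0 mulr1 addrC.
have [z [Jz _ ->]] := expand c; have [w [Jw _ ->]] := expand d.
have in_U a x : x \in J -> a *: p + x \in U.
  by move=> Jx; rewrite rpredD ?memvZ // -defU (subvP (addvSr _ _)).
move: (c 2%N *: p + z) (in_U (c 2%N) z Jz) (d 2%N *: p + w) (in_U (d 2%N) w Jw).
move=> x /(memv_radv _ alt_l) x0 y /(memv_radv _ alt_l) y0.
have y0' v : psi l0 v y = 0 by rewrite (altC alt_l y v) y0 oppr0.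
rewrite !(altDl alt_l) !(altDr alt_l) !(altZl alt_l) !(altZr alt_l) !x0 !y0' !(altxx alt_l).
by rewrite (altC alt_l r u); ring.
Qed.

End Pencil.

(** * Forms of small weight *)

Section MinimumWeight.
Variables (F : finFieldType) (V0 : vectType F) (e m : nat).
Local Notation V := (finvect_type V0).
Hypothesis card_F : #|F| = (2 ^ e)%N.
Variable eta : V -> F.
Hypothesis nondeg_eta : nondegenerate_quadratic_form eta.
Hypothesis dim_V : (\dim (fullv : {vspace V}) = m.+2.*2.+1)%N.
Variable r : V.
Hypothesis eta_r : eta r = 1.
Hypothesis rad_r : radv (polar eta) = <[r]>%VS.
Implicit Types (u w x y z : V) (A B U : {vspace V}).
Local Notation q := (#|F|%:Z).
Local Notation beta := (polar eta).
Local Notation G := (gauss_sum e eta).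
Local Notation R phi l := (radv (pencil phi beta l)).

Let quad_eta : quadratic_form eta := nondeg_eta.1.
Let alt_beta : alternating_form beta := alternating_polar card_F quad_eta.
Let q_ge2 : 2 <= q := card_field_ge2 F.
Let beta_r := nucleus_perp card_F nondeg_eta rad_r.
Let q_ge1 : 1 <= q := le_trans (isT : 1 <= 2 :> int) q_ge2.
Let q_ge0 : 0 <= q := ltW (card_field_gt0 F).

Lemma span_coord (s : seq V) x : (<<s>> = fullv)%VS ->
  exists c : nat -> F, x = \sum_(i < size s) c i *: s`_i.
Proof.
move=> span_s; have /coord_span def_x : x \in <<in_tuple s>>%VS by rewrite span_s memvf.
exists (fun j => if insub j is Some i then coord (in_tuple s) i x else 0).
by rewrite {1}def_x; apply: eq_bigr => i _; rewrite valK.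
Qed.

Lemma rank2_projectively_equivalent phi1 phi2 l1 l2 :
  alternating_form phi1 -> alternating_form phi2 ->
  r \notin R phi1 l1 -> \dim (R phi1 l1) = m.*2.+3 -> 0 < G (R phi1 l1) ->
  r \notin R phi2 l2 -> \dim (R phi2 l2) = m.*2.+3 -> 0 < G (R phi2 l2) ->
  projectively_equivalent (V := V) eta phi1 phi2.
Proof.
move=> alt1 alt2 nr1 dim1 G1 nr2 dim2 G2.
have [s1 [k1 [size1 span1 k1_neq0 eta1 psi1]]] :=
  normal_form card_F nondeg_eta dim_V eta_r rad_r alt1 nr1 dim1 G1.
have [s2 [k2 [size2 span2 k2_neq0 eta2 psi2]]] :=
  normal_form card_F nondeg_eta dim_V eta_r rad_r alt2 nr2 dim2 G2.
have free2 : free s2 by rewrite /free span2 dim_V size2; apply/eqP; lia.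
have [f map_f] := linear_of_free s2 s1.
have {map_f} map_f := map_f free2 (etrans size1 (esym size2)).
pose g : 'End(V) := linfun f.
have gE (c : nat -> F) :
    g (\sum_(i < m.*2 + 5) c i *: s2`_i) = \sum_(i < m.*2 + 5) c i *: s1`_i.
  rewrite lfunE linear_sum; apply: eq_bigr => i _; rewrite linearZ; congr (_ *: _).
  by rewrite -map_f (nth_map 0) // size2.
have coord2 x : exists c : nat -> F, x = \sum_(i < m.*2 + 5) c i *: s2`_i.
  by rewrite -size2; apply: span_coord.
have eta_g x : eta (g x) = eta x.
  by have [c ->] := coord2 x; rewrite gE eta1 eta2.
have beta_g x y : beta (g x) (g y) = beta x y.
  by rewrite /polar -linearD !eta_g.
(* The isometry g matches the two normal bases, so phi2 - l2 beta is k2 / k1 times the pullback of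
   phi1 - l1 beta; solving for phi2 gives the coefficient of beta. *)
exists g, 1, (k2 / k1), (l2 - k2 / k1 * l1); split.
- apply/eqP; rewrite -subv0; apply/subvP => x; rewrite memv_ker memv0 => /eqP gx0.
  apply/eqP/(nondeg_eta.2) => [y|]; first by rewrite -beta_g gx0 (alt0l alt_beta).
  by rewrite -eta_g gx0 (quad0 quad_eta).
- by split=> [|x]; rewrite ?oner_eq0 // mul1r eta_g.
- by rewrite mulf_neq0 ?invr_neq0.
move=> x y; have [c def_x] := coord2 x; have [d def_y] := coord2 y.
have := psi2 c d; have := psi1 c d; rewrite -!gE -def_x -def_y /pencil beta_g.
move/eqP; rewrite subr_eq => /eqP ->; move/eqP; rewrite subr_eq => /eqP ->.
by field.
Qed.

(** For the wedge of beta a and beta b with beta a b <> 0, the radical at l = 0 contains the perp of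
    <a, b>, of codimension 2, and the one at l = beta a b contains <r, a, b>, of dimension 3. Every
    other radical contains r, and the resulting lower bound meets the upper bound known when r lies
    in the radical. *)
Lemma second_pencil_weight_attained :
  exists2 phi, alternating_form (V := V) phi & pencil_weight e eta phi = second_pencil_weight F m.
Proof.
have [a nra] : exists a, a \notin radv beta.
  have : ~~ (fullv <= radv beta)%VS.
    apply/negP => /dimvS; rewrite dim_V rad_r dim_vline.
    by case: (r != 0).
  by case/subvPn => a _; exists a.
have [b _ ba] := notin_perp alt_beta nra.
have ab : beta a b != 0 by rewrite altC_eq0.
have alt_phi := alternating_wedge (alt_beta.1.2 a) (alt_beta.1.2 b).
exists (wedge (beta a) (beta b)) => //; set phi := wedge _ _ in alt_phi *.
have radP l x := mem_pencil_radv card_F nondeg_eta alt_phi l x.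
pose P := (<[a]> + <[b]>)%VS.
have beta_ar : beta a r = 0 by rewrite (altC alt_beta) beta_r oppr0.
have beta_br : beta b r = 0 by rewrite (altC alt_beta) beta_r oppr0.
have r_rad : r \in radv phi.
  by apply/(memv_radv _ alt_phi) => y; rewrite /phi /wedge beta_ar beta_br mul0r mulr0 subrr.
have rR l : r \in R phi l by rewrite (nucleus_pencil_radv card_F nondeg_eta rad_r alt_phi).
have sub0 : (perpv beta P <= R phi 0)%VS.
  apply/subvP => x; rewrite (perpD _ _ alt_beta) memv_cap
    (memv_perp_line a x alt_beta) (memv_perp_line b x alt_beta) => /andP[/eqP ax /eqP bx].
  by apply/radP => y; rewrite mul0r /phi /wedge ax bx mul0r mulr0 subrr.
have dimP : \dim (perpv beta P) = m.*2.+3.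
  have := dim_cap_perp_pair card_F alt_beta (memvf a) (memvf b) ab.
  by rewrite capfv dim_V !doubleS => -[].
have phi_a y : phi a y = beta a b * beta a y.
  by rewrite /phi /wedge (altxx alt_beta) (altC alt_beta a b); ring.
have phi_b y : phi b y = beta a b * beta b y.
  by rewrite /phi /wedge (altxx alt_beta); ring.
have Ra : a \in R phi (beta a b) by apply/radP.
have Rb : b \in R phi (beta a b) by apply/radP.
have dim1 : (3 <= \dim (R phi (beta a b)))%N.
  have nab : a \notin <[b]>%VS.
    by apply: contra ab => /vlineP[t ->]; rewrite (altZl alt_beta) (altxx alt_beta) mulr0.
  have b0 : b != 0 by apply: contraNneq ab => ->; rewrite (alt0r alt_beta).
  have nrP : r \notin P.
    apply/negP => /memv_addP[_ /vlineP[s ->] [_ /vlineP[t ->] def_r]].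
    have : s * beta a b = 0.
      have := beta_br; rewrite def_r (altDr alt_beta) !(altZr alt_beta) (altxx alt_beta).
      by rewrite (altC alt_beta a b) mulr0 addr0 mulrN => /eqP; rewrite oppr_eq0 => /eqP.
    have : t * beta a b = 0.
      have := beta_ar; rewrite def_r (altDr alt_beta) !(altZr alt_beta) (altxx alt_beta).
      by rewrite mulr0 add0r.
    move=> /eqP; rewrite mulf_eq0 (negbTE ab) orbF => /eqP t0.
    move=> /eqP; rewrite mulf_eq0 (negbTE ab) orbF => /eqP s0.
    have := nucleus_neq0 nondeg_eta eta_r.
    by rewrite def_r s0 t0 !scale0r addr0 eqxx.
  have <- : \dim (<[r]> + P) = 3%N by rewrite !dim_add_line // dim_vline b0.
  by rewrite dimvS // !subv_add -!memvE rR Ra Rb.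
have nfull l : R phi l != fullv.
  apply/negP => /eqP full.
  have l0 : l = 0.
    have : ~~ (perpv beta P <= radv beta)%VS.
      apply/negP => /dimvS; rewrite dimP rad_r dim_vline.
      by case: (r != 0).
    case/subvPn => x /(subvP sub0)/radP x0 nx.
    have [y _ yx] := notin_perp alt_beta nx.
    have /radP/(_ y) : x \in R phi l by rewrite full memvf.
    rewrite x0 mul0r => /esym/eqP; rewrite mulf_eq0 (altC_eq0 alt_beta) (negbTE yx) orbF.
    by move/eqP.
  have /radP/(_ b) : a \in R phi l by rewrite full memvf.
  rewrite phi_a l0 mul0r => /eqP; rewrite mulf_eq0 orbb.
  exact/negP.
apply/le_anti/andP; split.
  exact: (pencil_weight_le_of_nucleus card_F nondeg_eta dim_V eta_r rad_r alt_phi r_rad nfull).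
have -> : pencil_weight e eta phi = \sum_l q ^+ \dim (R phi l).
  by apply: eq_bigr => l _; rewrite (gauss_sum_nucleus card_F nondeg_eta eta_r rad_r) // mulr0 addr0.
rewrite (bigD1 0) // (bigD1 (beta a b)) //=.
have ge1 : \sum_(l | (l != 0) && (l != beta a b)) q <= \sum_(l | (l != 0) && (l != beta a b)) q ^+ \dim (R phi l).
  apply: ler_sum => l _; rewrite -[leLHS]expr1 ler_weXn2l // lt0n dimv_eq0.
  by apply: contraTneq (rR l) => ->; rewrite memv0 (nucleus_neq0 nondeg_eta eta_r).
have defsum : \sum_(l | (l != 0) && (l != beta a b)) q = (q - 2) * q.
  have := sum_neq_const (0 : F) q; rewrite (bigD1 (beta a b)) //= => /(canRL (addKr _)) ->.
  ring.
rewrite defsum in ge1.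
have ge2 : q ^+ m.*2.+3 <= q ^+ \dim (R phi 0) by rewrite ler_weXn2l // -dimP dimvS.
have ge3 : q ^+ 3 <= q ^+ \dim (R phi (beta a b)) by rewrite ler_weXn2l.
have -> : second_pencil_weight F m = q ^+ m.*2.+3 + (q ^+ 3 + (q - 2) * q).
  by rewrite /second_pencil_weight; ring.
by rewrite !lerD.
Qed.

(** The form is the wedge of beta p and g, where p is singular, g r = 1 and g p = 0. Its radical U
    is the common kernel; it has codimension 2, avoids r, and its beta-radical is spanned by p, so G
    U is q^n or -q^n. The sign can be corrected by changing g. *)
Lemma min_pencil_weight_attained :
  exists2 phi, alternating_form (V := V) phi & pencil_weight e eta phi = min_pencil_weight F m.
Proof.
have [y0 nry0] : exists y, y \notin <[r]>%VS.
  have : ~~ (fullv <= <[r]>)%VS.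
    by apply/negP => /dimvS; rewrite dim_V dim_vline; case: (r != 0).
  by case/subvPn => a _; exists a.
have [t t2] := sqr_root card_F (eta y0).
(* Adding t r adds t^2 to eta, so this choice of t makes p singular. *)
pose p := y0 + t *: r.
have nrp : p \notin <[r]>%VS by rewrite rpredDr // memvZ // memv_line.
have eta_p : eta p = 0.
  rewrite (quadD eta) (quadZ quad_eta) eta_r mulr1 -t2 (altZr alt_beta) (altC alt_beta) beta_r.
  by rewrite oppr0 mulr0 addr0 (addrr_pchar2 (pchar2_of_card card_F)).
have [u _ up] : exists2 u, u \in fullv & beta u p != 0.
  by apply: notin_perp => //; rewrite -[perpv _ _]/(radv _) rad_r.
have [g0 lin_g0 g0r] : exists2 g : V -> F, scalar g & g r = 1.
  have [i ri] : exists i, coord (vbasis fullv) i r != 0.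
    apply/existsP; apply: contraT; rewrite negb_exists => /forallP r0.
    have := nucleus_neq0 nondeg_eta eta_r; rewrite {1}(coord_vbasis (memvf r)).
    by rewrite big1 ?eqxx // => i _; have := r0 i; rewrite negbK => /eqP->; rewrite scale0r.
  exists (fun x => (coord (vbasis fullv) i r)^-1 * coord (vbasis fullv) i x).
    by move=> a x y /=; rewrite linearD linearZ /=; ring.
  by rewrite mulVf.
pose shift (g : V -> F) z x := g x + beta z x.
have lin_shift g z : scalar g -> scalar (shift g z).
  by move=> lin_g a x y; rewrite /shift lin_g (alt_beta.1.2 z) /=; ring.
have shift_r g z : shift g z r = g r by rewrite /shift (altC alt_beta) beta_r oppr0 addr0.
have [g1 [lin_g1 g1r g1p]] : exists g : V -> F, [/\ scalar g, g r = 1 & g p = 0].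
  (* The correction is a functional of the form beta z, which vanishes at r, so the value at r stays
     1. *)
  exists (shift g0 (- (g0 p / beta u p) *: u)); split; rewrite ?shift_r //.
    exact: lin_shift.
  by rewrite /shift (altZl alt_beta) mulNr divfK ?subrr.
have lin_f : scalar (beta p) := alt_beta.1.2 p.
have facts g : scalar g -> g r = 1 -> g p = 0 -> exists U : {vspace V},
    [/\ forall x, (x \in U) = (beta p x == 0) && (g x == 0),
        U = R (wedge (beta p) g) 0, r \notin U, \dim U = m.*2.+3 & G U ^+ 2 = (q ^+ m.+2) ^+ 2].
  move=> lin_g gr gp; have alt_phi := alternating_wedge lin_f lin_g.
  have radP x := mem_pencil_radv card_F nondeg_eta alt_phi 0 x.
  exists (R (wedge (beta p) g) 0).
  have memU x : (x \in R (wedge (beta p) g) 0) = (beta p x == 0) && (g x == 0).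
    apply/radP/andP => [x0 | [/eqP px /eqP gx] y]; last first.
      by rewrite /wedge px gx !(mul0r, mulr0) subrr.
    have px : beta p x = 0.
      have := x0 r; rewrite mul0r /wedge gr mulr1 (altC alt_beta r p) beta_r oppr0 mul0r subr0.
      by [].
    rewrite px eqxx; split=> //; have := x0 u; rewrite mul0r /wedge px mul0r sub0r => /eqP.
    by rewrite oppr_eq0 mulf_eq0 altC_eq0 // (negbTE up).
  set U := R _ 0 in memU *.
  have nrU : r \notin U by rewrite memU gr oner_eq0 andbF.
  have dimU : \dim U = m.*2.+3.
    have rp : r \in perpv beta <[p]> := nucleus_in_perp card_F nondeg_eta rad_r _.
    have gr0 : g r != 0 by rewrite gr oner_eq0.
    have := card_kernel card_F lin_g rp gr0.
    have -> : #|[pred y in perpv beta <[p]> | g y == 0]| = #|U|.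
      by apply: eq_card => x; rewrite !inE memv_perp_line // memU.
    rewrite !card_vspace_exp -exprS => /(congr1 (fun z : int => `|z|%N)).
    rewrite !abszX => /eqP; rewrite eqn_exp2l ?(card_field_gt1 F) // => /eqP dimU.
    have pu : beta p u != 0 by rewrite altC_eq0.
    have := dim_cap_perp_line card_F alt_beta (memvf u) pu.
    by rewrite capfv dim_V -dimU !doubleS => -[].
  split=> //.
  have dimN := dim_radical_rank2 card_F nondeg_eta dim_V rad_r nrU dimU.
  have Up : p \in U by rewrite memU gp (altxx alt_beta) eqxx.
  have Pp : p \in perpv beta U.
    apply/(memv_perp _ _ alt_beta) => y; rewrite memU => /andP[/eqP py _].
    by rewrite (altC alt_beta p y) py oppr0.
  have p0 : p != 0 by apply: contraNneq nrp => ->; rewrite mem0v.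
  have defN : (U :&: perpv beta U = <[p]>)%VS.
    by apply/eqP; rewrite eq_sym eqEdim -memvE memv_cap Up Pp dimN dim_vline p0.
  rewrite (gauss_sum_sqr_singular card_F quad_eta) => [|h Uh Ph].
    by rewrite dimU dimN -exprM; congr (_ ^+ _); lia.
  have : h \in <[p]>%VS by rewrite -defN memv_cap Uh.
  by case/vlineP => s ->; rewrite (quadZ quad_eta) eta_p mulr0.
have [g [lin_g gr gp [U [memU defU nrU dimU GU]]]] : exists g : V -> F,
    [/\ scalar g, g r = 1, g p = 0 & exists U : {vspace V},
    [/\ forall x, (x \in U) = (beta p x == 0) && (g x == 0),
        U = R (wedge (beta p) g) 0, r \notin U, \dim U = m.*2.+3 & G U = q ^+ m.+2]].
  have [U1 [memU1 defU1 nrU1 dimU1 GU1]] := facts g1 lin_g1 g1r g1p.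
  have q_pos : 0 < q ^+ m.+2 by rewrite exprn_gt0 // card_field_gt0.
  have := eqf_sqr (G U1) (q ^+ m.+2); rewrite GU1 eqxx => /esym/orP[/eqP G1 | /eqP G1].
    by exists g1; split=> //; exists U1.
  have [z Uz chi_z] : exists2 z, z \in U1 & chi e (eta z) = -1.
    have [/exists_inP[z Uz /eqP chi_z] | /exists_inPn chi1] :=
      boolP [exists z in U1, chi e (eta z) == -1]; first by exists z.
    have : 0 <= G U1.
      apply: sumr_ge0 => z /chi1; have := chi_pm1 e (eta z).
      by case/orP => /eqP->.
    by rewrite G1 oppr_ge0 leNgt q_pos.
  have /andP[/eqP pz /eqP gz] : (beta p z == 0) && (g1 z == 0) by rewrite -memU1.
  (* replacing g1 by shift g1 z multiplies the Gauss sum by chi (eta z) *)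
  pose g := shift g1 z; have lin_g : scalar g := lin_shift g1 z lin_g1.
  have gr : g r = 1 by rewrite /g shift_r.
  have gp : g p = 0 by rewrite /g /shift g1p add0r (altC alt_beta p z) pz oppr0.
  have [U [memU defU nrU dimU _]] := facts g lin_g gr gp.
  exists g; split=> //; exists U; split=> //.
  (* This map carries U1 onto U and adds the square of beta z x to eta x; chi ignores squaring, so
     the character value becomes chi (eta x + beta z x), that is, chi (eta (x + z)) * chi (eta
     z). *)
  pose tau x := x + beta z x *: r.
  have addxx (x : F) : x + x = 0 := addrr_pchar2 (pchar2_of_card card_F) x.
  have beta_tau w x : beta w (tau x) = beta w x.
    by rewrite /tau (altDr alt_beta) (altZr alt_beta) (altC alt_beta r w) beta_r oppr0 mulr0 addr0.
  have tau_inj : injective tau.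
    by move=> x y eq_xy; have := eq_xy; rewrite /tau -(beta_tau z x) eq_xy beta_tau => /addIr.
  have mem_tau x : (tau x \in U) = (x \in U1).
    rewrite memU memU1 beta_tau /g /shift beta_tau; congr (_ && (_ == _)).
    have -> : g1 (tau x) = beta z x + g1 x by rewrite /tau addrC lin_g1 /= g1r mulr1.
    by rewrite addrAC addxx add0r.
  rewrite /gauss_sum (reindex_inj tau_inj) (eq_bigl _ _ mem_tau).
  have -> : \sum_(x in U1) chi e (eta (tau x)) = \sum_(x in U1) chi e (eta (x + z)) * chi e (eta z).
    apply: eq_bigr => x _; rewrite /tau (quadD eta x (_ *: r)) (quadZ quad_eta) eta_r mulr1.
    rewrite (altZr alt_beta) (altC alt_beta r x) beta_r oppr0 mulr0 addr0.
    rewrite (quadD eta x z) (chiD card_F (eta x)) chi_sqr //.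
    rewrite (altC alt_beta x z) (oppr_pchar2 (pchar2_of_card card_F)).
    rewrite (chiD card_F (_ + _)) (chiD card_F (eta x)).
    by rewrite -[LHS]mulr1 -(chi_mulxx card_F (eta z)); ring.
  rewrite -mulr_suml chi_z mulrN1.
  have -> : \sum_(x in U1) chi e (eta (x + z)) = G U1.
    by rewrite /gauss_sum [RHS](reindex_inj (addIr z)); apply: eq_bigl => x /=; rewrite rpredDr.
  by rewrite G1 opprK.
have alt_phi := alternating_wedge lin_f lin_g.
exists (wedge (beta p) g) => //.
rewrite defU in nrU dimU GU.
have nr_phi : r \notin radv (wedge (beta p) g).
  by rewrite -(nucleus_pencil_radv card_F nondeg_eta rad_r alt_phi 0).
have := pencil_weight_rank2 card_F nondeg_eta dim_V eta_r rad_r alt_phi nr_phi dimU.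
by rewrite GU eqxx.
Qed.

(** * The two smallest weights of the code *)

Section LineCodeWeights.
Variables (M : nat) (omega : 'I_M -> V * V).
Hypothesis omega_lines : line_representatives (V := V) eta omega.
Local Notation code := (line_code (V := V) omega).
Local Notation cw phi := (codeword (V := V) omega phi).
Local Notation w phi := (hamming_weight (cw phi)).
Local Notation d1 := (#|F| ^ (4 * m + 3) - #|F| ^ (3 * m + 2))%N.
Local Notation d2 := (#|F| ^ (4 * m + 3) - #|F| ^ (2 * m + 1))%N.

Let Posz_subX i j : (j <= i)%N -> (#|F| ^ i - #|F| ^ j)%N%:Z = q ^+ i - q ^+ j.
Proof.
move=> le_ji; rewrite -subzn ?leq_exp2l ?card_field_gt1 //.
by rewrite -![Posz (_ ^ _)]natz !natrX !natz.
Qed.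

Let d1E : d1%:Z = q ^+ (4 * m + 3) - q ^+ (3 * m + 2).
Proof. by apply: Posz_subX; lia. Qed.

Let d2E : d2%:Z = q ^+ (4 * m + 3) - q ^+ (2 * m + 1).
Proof. by apply: Posz_subX; lia. Qed.

Let q2_gt0 : 0 < q ^+ 2 - 1.
Proof. by rewrite subr_gt0 exprn_egt1 // (lt_le_trans _ q_ge2). Qed.

Let Q2_gt0 : 0 < (q ^+ m) ^+ 2.
Proof. by rewrite !exprn_gt0 // card_field_gt0. Qed.

Lemma hamming_weight0 c : hamming_weight c = 0%N -> c = 0 :> 'rV[F]_M.
Proof.
move/eqP; rewrite cards_eq0 => /eqP c0; apply/rowP => i; apply/eqP.
by have := in_set0 i; rewrite -c0 inE !mxE => /negbFE.
Qed.

Lemma hamming_distanceE (c c' : 'rV[F]_M) : hamming_distance c c' = hamming_weight (c - c').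
Proof. by apply: eq_card => i; rewrite !inE !mxE subr_eq0. Qed.

(** A full radical means phi = l beta, which vanishes on every singular line. *)
Lemma nonzero_weight_radv phi : alternating_form phi -> (0 < w phi)%N ->
  forall l, R phi l != fullv.
Proof.
move=> alt_phi w_gt0 l; apply/negP => /eqP full; move: w_gt0; rewrite lt0n.
rewrite cards_eq0 -subset0 => /negP; apply; apply/subsetP => i.
rewrite inE !mxE; have /(mem_pencil_radv card_F nondeg_eta alt_phi) -> : (omega i).1 \in R phi l.
  by rewrite full memvf.
have [sing _ _] := omega_lines.
by rewrite (singular_line_polar (sing i).2) ?memvE ?addvSl ?addvSr // mulr0 eqxx.
Qed.

Lemma weight_ge_min phi : alternating_form phi -> (0 < w phi)%N -> (d1 <= w phi)%N.
Proof.
move=> alt_phi w_gt0; have eq_w := hamming_weight_min card_F nondeg_eta dim_V eta_r rad_r alt_phi omega_lines.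
have le_pw : pencil_weight e eta phi <= min_pencil_weight F m.
  have := pencil_weight_dichotomy card_F nondeg_eta dim_V eta_r rad_r alt_phi (nonzero_weight_radv alt_phi w_gt0).
  by case=> [[_ ->] | [/ltW]].
rewrite -lez_nat d1E -subr_ge0 -(pmulr_rge0 _ q2_gt0) eq_w.
by rewrite mulr_ge0 ?subr_ge0 // ltW.
Qed.

Lemma weight_eq_min phi : alternating_form phi ->
  (w phi == d1) = (pencil_weight e eta phi == min_pencil_weight F m).
Proof.
move=> alt_phi; have eq_w := hamming_weight_min card_F nondeg_eta dim_V eta_r rad_r alt_phi omega_lines.
rewrite -eqz_nat d1E -subr_eq0 [RHS]eq_sym -[RHS]subr_eq0.
have := congr1 (fun t : int => t == 0) eq_w.
by rewrite mulf_eq0 (gt_eqF q2_gt0) [in RHS]mulf_eq0 (gt_eqF Q2_gt0).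
Qed.

Lemma weight_ge_second phi : m <> 1%N -> alternating_form phi ->
  (d1 < w phi)%N -> (d2 <= w phi)%N.
Proof.
move=> m_neq1 alt_phi lt_w; have w_gt0 : (0 < w phi)%N := leq_ltn_trans (leq0n _) lt_w.
have eq_w := hamming_weight_second card_F nondeg_eta dim_V eta_r rad_r alt_phi omega_lines.
rewrite -lez_nat d2E -subr_ge0 -(pmulr_rge0 _ q2_gt0) eq_w.
rewrite mulr_ge0 ?subr_ge0 //; first exact: ltW.
have := pencil_weight_dichotomy card_F nondeg_eta dim_V eta_r rad_r alt_phi (nonzero_weight_radv alt_phi w_gt0).
case=> [[_ /eqP] | [_ /(_ m_neq1)] //].
by rewrite -weight_eq_min // gtn_eqF.
Qed.

Lemma weight_eq_second phi : alternating_form phi ->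
  (w phi == d2) = (pencil_weight e eta phi == second_pencil_weight F m).
Proof.
move=> alt_phi; have eq_w := hamming_weight_second card_F nondeg_eta dim_V eta_r rad_r alt_phi omega_lines.
rewrite -eqz_nat d2E -subr_eq0 [RHS]eq_sym -[RHS]subr_eq0.
have := congr1 (fun t : int => t == 0) eq_w.
by rewrite mulf_eq0 (gt_eqF q2_gt0) [in RHS]mulf_eq0 (gt_eqF Q2_gt0).
Qed.

Let d1_gt0 : (0 < d1)%N.
Proof. by rewrite subn_gt0 ltn_exp2l ?card_field_gt1 //; lia. Qed.

Let lt_d12 : (d1 < d2)%N.
Proof.
rewrite -ltz_nat d1E d2E ltrD2l ltrN2 ltr_eXn2l ?(lt_le_trans _ q_ge2) //; lia.
Qed.

Lemma least_nonzero_weight : least (nonzero_weight code) d1.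
Proof.
split=> [|k [k_gt0 [_ [phi alt_phi ->] def_k]]].
  have [phi alt_phi pw] := min_pencil_weight_attained.
  split=> //; exists (cw phi); first by exists phi.
  by apply/esym/eqP; rewrite weight_eq_min // pw.
by rewrite def_k in k_gt0 *; apply: weight_ge_min.
Qed.

Lemma minimum_distance_line_code : minimum_distance code d1.
Proof.
have [[_ [c Cc def_d1]] min_d1] := least_nonzero_weight.
split=> [|_ [_ [_ [[phi alt_phi ->] [phi' alt_phi' ->] neq_c ->]]]].
  exists c, 0; split=> //.
    exists (fun _ _ => 0); last by apply/rowP => i; rewrite !mxE.
    by split=> //; split=> z a x y /=; rewrite mulr0 addr0.
  move=> c0; move: d1_gt0; rewrite def_d1 c0 lt0n cards_eq0 -subset0 => /negP; apply.
  by apply/subsetP => i; rewrite inE eqxx.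
rewrite hamming_distanceE; apply: min_d1; split.
  rewrite lt0n; apply/eqP => /hamming_weight0/eqP; rewrite subr_eq0 => /eqP.
  exact: neq_c.
exists (cw phi - cw phi') => //; exists (pencil phi phi' 1).
  exact: alternating_pencil.
by apply/rowP => i; rewrite !mxE /pencil mul1r.
Qed.

(** Minimum weight forces the largest Theta, hence a radical of codimension 2 with positive Gauss
    sum, and all forms with such a radical share one normal form. *)
Lemma minimum_weight_codewords_equivalent phi phi' :
  alternating_form phi -> alternating_form phi' ->
  minimum_weight_codeword code (cw phi) -> minimum_weight_codeword code (cw phi') ->
  projectively_equivalent (V := V) eta phi phi'.
Proof.
have rank2 psi : alternating_form psi -> minimum_weight_codeword code (cw psi) ->
    exists l, [/\ r \notin R psi l, \dim (R psi l) = m.*2.+3 & 0 < G (R psi l)].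
  move=> alt_psi [_ [[w_gt0 _] min_w]]; have [d1_w min_d1] := least_nonzero_weight.
  have w_d1 : w psi == d1 by rewrite eqn_leq min_w // weight_ge_min.
  rewrite weight_eq_min // in w_d1.
  have := pencil_weight_dichotomy card_F nondeg_eta dim_V eta_r rad_r alt_psi (nonzero_weight_radv alt_psi w_gt0).
  case=> [[[l [nr dimR GR]] _] | [lt_pw _]]; last by rewrite (eqP w_d1) ltxx in lt_pw.
  by exists l; split=> //; rewrite GR exprn_gt0 // card_field_gt0.
move=> alt_phi alt_phi' /(rank2 _ alt_phi)[l [nr dimR GR]] /(rank2 _ alt_phi')[l' [nr' dimR' GR']].
exact: (rank2_projectively_equivalent alt_phi alt_phi' nr dimR GR nr' dimR' GR').
Qed.

Lemma second_smallest_distance_line_code : m <> 1%N -> second_smallest_distance code d2.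
Proof.
move=> m_neq1; have [d1_w min_d1] := least_nonzero_weight.
split=> [|k [[k_gt0 [_ [phi alt_phi ->] def_k]] [j /min_d1 le_j lt_jk]]].
  split; last by exists d1.
  have [phi alt_phi pw] := second_pencil_weight_attained.
  split; first exact: ltn_trans lt_d12.
  exists (cw phi); first by exists phi.
  by apply/esym/eqP; rewrite weight_eq_second // pw.
rewrite def_k in lt_jk *; apply: weight_ge_second => //.
exact: leq_ltn_trans lt_jk.
Qed.

End LineCodeWeights.
End MinimumWeight.

Theorem mainTheorem1 (F : finFieldType) (q e n : nat)
    (card_F : #|F| = q) (q_even : q = (2 ^ e)%N) (n_ge2 : (2 <= n)%N)
    (V : vectType F) (dim_V : (\dim {:V} = 2 * n + 1)%N)
    (eta : V -> F) (eta_nondeg : nondegenerate_quadratic_form eta)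
    (M : nat) (omega : 'I_M -> V * V)
    (omega_lines : line_representatives eta omega) :
  [/\ minimum_distance (line_code omega)
        (q ^ (4 * n - 5) - q ^ (3 * n - 4))%N,
      forall phi psi : V -> V -> F,
        alternating_form phi -> alternating_form psi ->
        minimum_weight_codeword (line_code omega) (codeword omega phi) ->
        minimum_weight_codeword (line_code omega) (codeword omega psi) ->
        projectively_equivalent eta phi psi
    & n <> 3%N ->
      second_smallest_distance (line_code omega)
        (q ^ (4 * n - 5) - q ^ (2 * n - 3))%N].
Proof.
have card_F2 : #|F| = (2 ^ e)%N by rewrite card_F.
have [m def_n] : exists m, n = m.+2 by exists (n - 2)%N; lia.
(* once V is a constructor, its finite copy finvect_type V is convertible to it *)
case: V dim_V eta eta_nondeg omega omega_lines => T cT.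
set V := vector.Vector.Pack _ => dim_V eta eta_nondeg omega omega_lines.
have dimV : \dim (fullv : {vspace finvect_type V}) = m.+2.*2.+1.
  by apply: etrans dim_V _; rewrite def_n; lia.
have [r eta_r rad_r] := nucleus_exists card_F2 eta_nondeg dimV.
rewrite -card_F def_n.
have -> : (4 * m.+2 - 5 = 4 * m + 3)%N by lia.
have -> : (3 * m.+2 - 4 = 3 * m + 2)%N by lia.
have -> : (2 * m.+2 - 3 = 2 * m + 1)%N by lia.
split.
- exact: (minimum_distance_line_code card_F2 eta_nondeg dimV eta_r rad_r omega_lines).
- exact: (minimum_weight_codewords_equivalent card_F2 eta_nondeg dimV eta_r rad_r omega_lines).
move=> m_neq1.
apply: (second_smallest_distance_line_code card_F2 eta_nondeg dimV eta_r rad_r omega_lines) => m1.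
by rewrite m1 in m_neq1.
Qed.
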